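(* Let $n\geq 4$ and $t\geq 4$ be integers and let $g_n(x;t)=x^n-(t+3)x^{n-1}+tx+1\in\mathbf{Z}[x]$. Then: (i) $g_n(x;t)$ is irreducible over $\mathbf{Q}$; (ii) for any root $\alpha$ of $g_n(x;t)$, the number field $\mathbf{Q}(\alpha)$ is exceptional ($\alpha$ is an exceptional unit); (iii) for $n=4$, all roots of $g_4(x;t)$ are real, so any root generates a quartic number field $L$ whose unit group has rank $3$, and the Galois group of $g_4(x;t)$ over $\mathbf{Q}$ is the symmetric group $S_4$; (iv) this quartic field $L$ has no quadratic subfield.
   Context: For a number field $F$ with ring of integers $\mathcal{O}_F$, a unit $\lambda\in\mathcal{O}_F^\times$ is called an exceptional unit if $1-\lambda$ is also a unit of $\mathcal{O}_F$. A number field is called exceptional if its ring of integers contains an exceptional unit. *)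

(* Defs.v *)
From mathcomp Require Import all_boot all_order all_algebra all_fingroup.
From mathcomp Require Import all_solvable all_field.

Set Implicit Arguments.
Unset Strict Implicit.
Unset Printing Implicit Defensive.

Import GRing.Theory Num.Theory.
Local Open Scope ring_scope.

Definition g (n : nat) (t : int) : {poly int} :=
  'X^n - (t + 3) *: 'X^(n.-1) + t *: 'X + 1.

Definition g_over (K : nzRingType) (n : nat) (t : int) : {poly K} :=
  map_poly (intr : int -> K) (g n t).

(* A number field is a subfield E of some finite extension L of Q; the case
   E = {:L} is L itself. *)
Section NumberField.

Variables (L : fieldExtType rat) (E : {subfield L}).

Definition in_ring_of_integers (x : L) : Prop :=
  x \in E /\ integralOver (intr : int -> L) x.

Definition is_integer_unit (x : L) : Prop :=
  in_ring_of_integers x /\ exists2 y, in_ring_of_integers y & x * y = 1.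

Definition exceptional_unit (x : L) : Prop :=
  is_integer_unit x /\ is_integer_unit (1 - x).

Definition exceptional_field : Prop := exists x, exceptional_unit x.

(* u_0, ..., u_{k-1} are Z-linearly independent in the abelian group L^*. *)
Definition multiplicatively_independent (k : nat) (u : 'I_k -> L) : Prop :=
  forall e : 'I_k -> int, \prod_i u i ^ e i = 1 -> forall i, e i = 0.

(* The rank of the abelian group O_E^*: the maximal size of a Z-linearly
   independent family. *)
Definition unit_group_rank (r : nat) : Prop :=
  (exists2 u : 'I_r -> L,
     forall i, is_integer_unit (u i) & multiplicatively_independent u) /\
  (forall (k : nat) (u : 'I_k -> L),
     (forall i, is_integer_unit (u i)) -> multiplicatively_independent u ->
     (k <= r)%N).

End NumberField.

(* Main.v *)
(* Since |t + 3| exceeds the sum of the moduli of the other coefficients, g_n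
   has a single, simple root outside the open unit disc, while every
   nonconstant integer factor has such a root because g_n(0) = 1; this gives
   irreducibility. Moreover g_n(0) = 1 and g_n(1) = -1 make alpha and
   1 - alpha units.
   For n = 4, sign changes at -1, -1/2, 0, 1, t + 3 show that the field is
   totally real, and its unit rank is that of Dirichlet's theorem, proved here
   by the pigeonhole principle. The cubic resolvent of g_4 has no rational root
   and the discriminant is congruent to 5 modulo 8, so the Galois group has
   order divisible by 12 and contains an odd permutation: it is S_4. A quadratic
   subfield K would split g_4 into two quadratics over K, and then K would
   contain a root of the resolvent, which has degree 3. *)
From HB Require Import structures.
Require Import Defs.
From mathcomp Require Import all_boot all_order all_algebra all_fingroup.
From mathcomp Require Import all_solvable all_field.
From mathcomp Require Import zify ring lra.

Set Implicit Arguments.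
Unset Strict Implicit.
Unset Printing Implicit Defensive.

Import Order.TTheory GRing.Theory Num.Theory.
Local Open Scope ring_scope.

(** * Dirichlet's unit theorem for totally real rings *)

(** The conjugates live in the real algebraic numbers, which are not closed under logarithms, so
    Dirichlet's theorem is stated over an archimedean real field. Dyadic intervals replace
    logarithms, counting replaces lattice volumes, and sizes of conjugates at chosen places replace
    the regulator determinant. The two halves of the rank are independent: n+1 units always satisfy
    a relation, and n units, each small at all places but its own, satisfy none. Uniqueness and
    simplicity of the large root use no contour argument. A root outside the open unit disc has
    modulus at least 2, so its reciprocal lies in the disc of radius 1/2, where the reciprocal
    equation is dominated by its linear term. The cubic resolvent serves three times: its degree
    gives the factor 3 of the group order and excludes quadratic subfields, and its discriminant is
    that of the quartic. It has no quadratic term because the coefficient of X^2 in g_4 is 0. *)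

Lemma pigeonhole (A B : finType) (f : A -> B) :
  (#|B| < #|A|)%N -> exists x y, x != y /\ f x = f y.
Proof.
move=> ltBA; have /injectivePn[x [y neq_xy eqf]] : ~~ injectiveb f.
  by apply: contraL ltBA => /injectiveP/leq_card; rewrite -leqNgt.
by exists x, y.
Qed.

Lemma prod_lt1 (R : realDomainType) (I : finType) (P : pred I) (a : I -> R) (j : I) :
  P j -> (forall i, P i -> 0 <= a i < 1) -> \prod_(i | P i) a i < 1.
Proof.
move=> Pj a01; rewrite (bigD1 j) //=.
have [a0 a1] := andP (a01 _ Pj).
apply: le_lt_trans a1; rewrite ler_piMr //.
by apply: prodr_ile1 => i /andP[/a01/andP[-> /ltW]].
Qed.

Lemma truncn_eq_dist (R : archiRealFieldType) (x y : R) :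
  0 <= x -> 0 <= y -> Num.truncn x = Num.truncn y -> `|x - y| < 1.
Proof.
move=> x0 y0 eqxy.
have := truncn_itv x0; have := truncn_itv y0; rewrite eqxy -natr1.
by move=> /andP[? ?] /andP[? ?]; rewrite ltr_norml; apply/andP; split; lra.
Qed.

(** Substitute for the integer part of the base 2 logarithm; it confines [y] to one of finitely many
    cells. *)
Lemma dyadic_scale (R : archiRealFieldType) (y : R) (D : nat) :
  1 <= y <= 2 ^+ D -> exists m : 'I_D.+1, 2 ^+ m <= y < 2 ^+ m.+1.
Proof.
case/andP=> y1 yD; have y0 : 0 <= y by lra.
have t0 : (0 < Num.truncn y)%N by rewrite truncn_gt0.
have [ty yt] := andP (truncn_itv y0).
have [lb ub] := andP (trunc_log_bounds (isT : (1 < 2)%N) t0).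
have mD : (trunc_log 2 (Num.truncn y) < D.+1)%N.
  rewrite ltnS -(leq_exp2l _ _ (isT : (1 < 2)%N)) (leq_trans lb) //.
  by rewrite -(ler_nat R) (le_trans ty) // natrX.
exists (Ordinal mD) => /=; rewrite -!natrX; apply/andP; split.
  by rewrite (le_trans _ ty) ?ler_nat.
by rewrite (lt_le_trans yt) ?ler_nat.
Qed.

Section Embeddings.

Variables (R : archiRealFieldType) (F : fieldType) (n : nat).
Variables (sigma : 'I_n.+1 -> {rmorphism F -> R}) (O : F -> Prop).
Hypotheses (O1 : O 1) (OB : forall x y, O x -> O y -> O (x - y)).
Hypothesis OM : forall x y, O x -> O y -> O (x * y).
(** The arithmetic content of [O]: norms are rational integers, and an element divides its norm
    inside [O]. The first part bounds norms of nonzero elements below by 1, the second produces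
    inverses. *)
Hypothesis O_norm : forall x, O x -> x != 0 ->
  exists2 m : int, \prod_i sigma i x = m%:~R & O (m%:~R / x).

Let norm_neq0 x : x != 0 -> \prod_i sigma i x != 0.
Proof. by move=> x0; apply/prodf_neq0 => i _; rewrite fmorph_eq0. Qed.

Let norm_ge1 x : O x -> x != 0 -> 1 <= \prod_i `|sigma i x|.
Proof.
move=> Ox x0; have [m Nm _] := O_norm Ox x0; have := norm_neq0 x0.
rewrite -normr_prod Nm intr_eq0 -intr_norm -[1](mulr1z 1) ler_int => m0.
by rewrite -gtz0_ge1 normr_gt0.
Qed.

Definition O_unit x := [/\ x != 0, O x & O x^-1].

Lemma O_unit_norm x : O_unit x -> \prod_i `|sigma i x| = 1.
Proof.
case=> x0 Ox OV; apply/eqP; rewrite eq_le norm_ge1 // andbT.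
have: 1 <= \prod_i `|sigma i x^-1| by rewrite norm_ge1 ?invr_eq0.
under eq_bigr do rewrite fmorphV normfV.
rewrite prodfV invr_ge1 //; first by rewrite unitfE; apply/prodf_neq0 => i _; rewrite normr_eq0 fmorph_eq0.
by apply: prodr_gt0 => i _; rewrite normr_gt0 fmorph_eq0.
Qed.

Lemma O_unitM x y : O_unit x -> O_unit y -> O_unit (x * y).
Proof.
move=> [x0 Ox OVx] [y0 Oy OVy]; split; rewrite ?mulf_neq0 //; first exact: OM.
by rewrite invfM; apply: OM.
Qed.

Lemma O_unit1 : O_unit 1.
Proof. by split; rewrite ?oner_eq0 ?invr1. Qed.

Lemma O_unit_prod (k : nat) (u : 'I_k -> F) (e : 'I_k -> nat) :
  (forall i, O_unit (u i)) -> O_unit (\prod_i u i ^+ e i).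
Proof.
move=> Uu; elim/big_ind: _ => [|x y|i _]; [exact: O_unit1|exact: O_unitM|].
by elim: (e i) => [|m IH]; rewrite ?expr0 ?exprS; [exact: O_unit1|exact: O_unitM].
Qed.

(** With [Q = C.+1] exponents available for each of n+1 units, the monomials outnumber [C * Q ^ n]
    cells: one more unit than logarithmic dimensions. *)
Let exp_lt (C : nat) : (C * C.+1 ^ n < C.+1 ^ n.+1)%N.
Proof. by rewrite expnS ltn_pmul2r // expn_gt0. Qed.

(* Two monomials in the u_k whose logarithmic images lie in the same cell have
   a difference of norm less than 1. *)
Theorem O_units_dependent (u : 'I_n.+1 -> F) : (forall k, O_unit (u k)) ->
  exists2 e : 'I_n.+1 -> int, \prod_k u k ^ e k = 1 & exists k, e k != 0.
Proof.
move=> Uu.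
have [c cP] : exists c : nat, forall i k, 2 ^- c <= `|sigma i (u k)| <= 2 ^+ c.
  have [c cP] : exists c : nat, forall p : 'I_n.+1 * 'I_n.+1,
      (Num.truncn `|sigma p.1 (u p.2)| + Num.truncn `|sigma p.1 (u p.2)|^-1 < c)%N.
    by exists (\max_(p : 'I_n.+1 * 'I_n.+1)
      (Num.truncn `|sigma p.1 (u p.2)| + Num.truncn `|sigma p.1 (u p.2)|^-1)).+1%N => p;
      rewrite ltnS (leq_bigmax p).
  exists c => i k; have /= ltc := cP (i, k).
  have s0 : 0 < `|sigma i (u k)| by rewrite normr_gt0 fmorph_eq0; case: (Uu k).
  have c2 : (c%:R : R) <= 2 ^+ c by rewrite -natrX ler_nat ltnW // ltn_expl.
  have bound (y : R) : 0 <= y -> (Num.truncn y < c)%N -> y <= 2 ^+ c.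
    by move=> y0; rewrite truncn_lt_nat // => /lt_le_trans/(_ c2)/ltW.
  apply/andP; split; last by apply: bound; rewrite ?normr_ge0 //; lia.
  rewrite -[leRHS]invrK lef_pV2 ?posrE ?invr_gt0 ?exprn_gt0 //.
  by apply: bound; rewrite ?invr_ge0 ?normr_ge0 //; lia.
(* There are (2D+1)^n dyadic cells and 5^(n+1) cells for the rescaled conjugates. Since 2D+1 is at
   most (2c(n+1)+1)Q, their product is at most K Q^n, and K does not depend on Q. *)
pose K := ((2 * (c * n.+1)).+1 ^ n * 5 ^ n.+1)%N.
pose Q := K.+1; pose D := (c * n.+1 * Q)%N.
pose x (e : {ffun 'I_n.+1 -> 'I_Q}) := \prod_k u k ^+ e k.
have Ux e : O_unit (x e) by apply: O_unit_prod.
have xD i e : 1 <= `|sigma i (x e)| * 2 ^+ D <= 2 ^+ (2 * D).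
  have b2 : 2 ^- D <= `|sigma i (x e)| <= 2 ^+ D.
    rewrite /x rmorph_prod normr_prod.
    have -> : (2 ^+ D : R) = \prod_(k < n.+1) 2 ^+ (c * Q).
      by rewrite prodr_const card_ord -exprM /D mulnAC.
    rewrite -prodfV; apply/andP; split; apply: ler_prod => k _;
      have [lo hi] := andP (cP i k);
      rewrite rmorphXn normrX ?exprn_ge0 ?invr_ge0 ?exprn_ge0 //= exprM.
      rewrite -exprVn (@le_trans _ _ (2 ^- c ^+ e k)) //; last first.
        by rewrite lerXn2r ?nnegrE ?normr_ge0 ?invr_ge0 ?exprn_ge0.
      by rewrite ler_wiXn2l ?invr_ge0 ?exprn_ge0 ?invf_le1 ?exprn_gt0 ?exprn_ege1 ?ler1n // ltnW.
    rewrite (@le_trans _ _ ((2 ^+ c) ^+ e k)) //; first by rewrite lerXn2r ?nnegrE ?normr_ge0 ?exprn_ge0.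
    by rewrite ler_weXn2l ?exprn_ege1 ?ler1n // ltnW.
  have d0 : 0 < 2 ^+ D :> R by rewrite exprn_gt0.
  case/andP: b2 => lo hi; rewrite -ler_pdivrMr // mul1r lo /=.
  by rewrite mul2n -addnn exprD ler_pM2r.
have mP e (i : 'I_n) := dyadic_scale (xD (lift ord_max i) e).
pose m e i := xchoose (mP e i).
(* [s e] approximates the conjugates of [x e] by powers of 2. The last entry is forced by requiring
   product 1; since [x e] has norm of modulus 1, it is still an upper bound for the last
   conjugate. *)
pose s e (i : 'I_n.+1) : R := if unlift ord_max i is Some j then 2 ^+ (m e j) / 2 ^+ D
  else \prod_(j < n) (2 ^+ (m e j) / 2 ^+ D)^-1.
have s_gt0 e i : 0 < s e i.
  rewrite /s; case: unliftP => [j _|_]; first by rewrite divr_gt0 ?exprn_gt0.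
  by apply: prodr_gt0 => j _; rewrite invr_gt0 divr_gt0 ?exprn_gt0.
have s_prod e : \prod_i s e i = 1.
  rewrite (bigD1_ord ord_max) //= {1}/s unlift_none prodfV.
  under [X in _ * X]eq_bigr do rewrite /s liftK.
  by rewrite mulVf //; apply/prodf_neq0 => j _; rewrite mulf_neq0 ?invr_eq0 ?expf_neq0 // pnatr_eq0.
have sP e i : `|sigma i (x e) / s e i| <= 2.
  have lo (j : 'I_n) : 2 ^+ m e j / 2 ^+ D <= `|sigma (lift ord_max j) (x e)| <= 2 * (2 ^+ m e j / 2 ^+ D).
    have /andP[lo /ltW hi] := xchooseP (mP e j).
    by rewrite mulrA -exprS ler_pdivrMr ?exprn_gt0 // lo ler_pdivlMr ?exprn_gt0.
  rewrite normrM normfV (gtr0_norm (s_gt0 e i)) ler_pdivrMr //.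
  rewrite /s; case: unliftP => [j ->|->]; first by case/andP: (lo j).
  have := O_unit_norm (Ux e); rewrite (bigD1_ord ord_max) //=.
  rewrite prodfV => /(canRL (mulfK _)) ->; last first.
    by apply/prodf_neq0 => j _; rewrite normr_eq0 fmorph_eq0; case: (Ux e).
  have p0 : 0 < \prod_(j < n) (2 ^+ m e j / 2 ^+ D) :> R by apply: prodr_gt0 => j _; rewrite divr_gt0 ?exprn_gt0.
  have pp : \prod_(j < n) (2 ^+ m e j / 2 ^+ D) <= \prod_(j < n) `|sigma (lift ord_max j) (x e)|.
    apply: ler_prod => j _; case/andP: (lo j) => -> _; rewrite andbT.
    by rewrite ltW // divr_gt0 ?exprn_gt0.
  rewrite mul1r (le_trans (y := (\prod_(j < n) (2 ^+ m e j / 2 ^+ D))^-1)) //.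
    by rewrite lef_pV2 ?posrE // (lt_le_trans p0 pp).
  by rewrite ler_peMl ?invr_ge0 ?ltW // ltr1n.
(* The ratio lies in [-2, 2] and keeps its sign; the shift moves it to [0, 4], both ends included,
   hence five possible integer parts. *)
pose z e i := sigma i (x e) / s e i + 2.
have z0 e i : 0 <= z e i < 4.+1%:R.
  by have := sP e i; rewrite ler_norml /z => /andP[? ?]; apply/andP; split; lra.
have zt e i : (Num.truncn (z e i) < 5)%N by case/andP: (z0 e i) => ? ?; rewrite truncn_lt_nat.
pose col e := ([ffun i => m e i], [ffun i => Ordinal (zt e i)]).
have [|e [e' [neq_e [/ffunP eqm /ffunP eqz]]]] := @pigeonhole _ _ col.
  rewrite card_prod !card_ffun !card_ord.
  apply: leq_trans (exp_lt K); rewrite ltnS /K -/K mulnAC leq_mul //.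
  have leX a b : (a <= b)%N -> (a ^ n <= b ^ n)%N by case: (n) => // k; rewrite leq_exp2r.
  by rewrite -expnMn leX // /D [leqRHS]mulSn -!mulnA -add1n leq_add2r.
have eqs i : s e i = s e' i.
  rewrite /s; case: unliftP => [j _|_]; first by have := eqm j; rewrite !ffunE => ->.
  by apply: eq_bigr => j _; have := eqm j; rewrite !ffunE => ->.
have eqx : x e = x e'.
  apply/eqP; rewrite -subr_eq0; apply/negP => /negP nz.
  have /norm_ge1 /(_ nz) : O (x e - x e') by apply: OB; [case: (Ux e)|case: (Ux e')].
  apply/negP; rewrite -ltNge.
  (* Equal colours give equal scales, which cancel because they multiply to 1; each remaining factor
     is below 1, whereas a nonzero element of [O] has norm at least 1. *)
  have -> : \prod_i `|sigma i (x e - x e')| = \prod_i `|z e i - z e' i|.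
    transitivity ((\prod_i `|z e i - z e' i|) * \prod_i s e i); last by rewrite s_prod mulr1.
    rewrite -big_split; apply: eq_bigr => i _ /=.
    rewrite -(gtr0_norm (s_gt0 e i)) -normrM /z -eqs rmorphB; congr `|_|.
    by field; rewrite gt_eqF.
  apply: (prod_lt1 (j := ord0)) => // i _; rewrite normr_ge0 truncn_eq_dist //.
  - by case/andP: (z0 e i).
  - by case/andP: (z0 e' i).
  - by have := congr1 val (eqz i); rewrite !ffunE.
exists (fun k => (e k)%:Z - (e' k)%:Z).
  apply: (mulIf (x := x e')); first by case: (Ux e').
  rewrite mul1r -{2}eqx /x -big_split; apply: eq_bigr => k _ /=.
  by rewrite !exprnP -expfzDr ?subrK //; case: (Uu k).
have /forallPn[k ek] : ~~ [forall k, e k == e' k].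
  by apply: contra neq_e => /forallP eqe; apply/eqP/ffunP => k; apply/eqP.
by exists k; rewrite subr_eq0 eqz_nat.
Qed.

(* If the set P of indices with e_k > 0 is nonempty, then the product of the
   places indexed by P is greater than 1 on every u_l ^ e_l with e_l != 0. *)
Lemma off_diagonal_units_independent (u : 'I_n -> F) :
  (forall k, O_unit (u k)) ->
  (forall k i, i != lift ord_max k -> `|sigma i (u k)| < 1) ->
  forall e : 'I_n -> int, \prod_k u k ^ e k = 1 -> forall k, e k = 0.
Proof.
move=> Uu small e.
have s_gt0 i l : 0 < `|sigma i (u l)| by rewrite normr_gt0 fmorph_eq0; case: (Uu l).
wlog suff: e / \prod_k u k ^ e k = 1 -> forall k, e k <= 0.
  move=> le0 e1 k; apply/eqP; rewrite eq_le le0 //=.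
  rewrite -oppr_le0; apply: (le0 (fun k => - e k)) => {k}.
  by under eq_bigr do rewrite -invr_expz; rewrite prodfV e1 invr1.
move=> e1 k0; rewrite leNgt; apply/negP => k0P.
pose b l := \prod_(k | 0 < e k) `|sigma (lift ord_max k) (u l)|.
have b_gt0 l : 0 < b l by apply: prodr_gt0.
(* All conjugates of [u l] multiply to modulus 1. When 0 < e_l, the places left out of [b l] are all
   small on [u l], and [ord_max] is always one of them, so the inequality is strict. *)
have b_gt1 l : 0 < e l -> 1 < b l.
  move=> el; have := O_unit_norm (Uu l); rewrite (bigD1_ord ord_max) //= (bigID (fun k => 0 < e k)) /=.
  rewrite -/(b l) mulrCA => bE; rewrite -[ltLHS]bE gtr_pMr //.
  apply: le_lt_trans (small l ord_max _); last by rewrite neq_lift.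
  rewrite ler_piMr //.
  apply: prodr_ile1 => k; rewrite -leNgt => ek.
  by rewrite normr_ge0 ltW // small // (inj_eq lift_inj); apply: contraTneq el => <-; rewrite -leNgt.
have b_lt1 l : e l <= 0 -> b l < 1.
  move=> el; apply: (prod_lt1 (j := k0)) => // k ek.
  by rewrite normr_ge0 small // (inj_eq lift_inj); apply: contraTneq el => <-; rewrite -ltNge.
have be l : 1 <= b l ^ e l.
  have [el|el] := ltP 0 (e l); first by case: (e l) el (b_gt1 l) => // m el /(_ el)/ltW b1; rewrite -exprnP exprn_ege1.
  have := b_lt1 _ el; case: (e l) el => [[|//]|m] _ blt; first by rewrite expr0z.
  by rewrite NegzE -exprz_inv -exprnP exprn_ege1 // invf_ge1 ?ltW.
have : \prod_l b l ^ e l = 1.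
  transitivity (\prod_(k | 0 < e k) `|sigma (lift ord_max k) (\prod_l u l ^ e l)|); last first.
    by rewrite e1; under eq_bigr do rewrite rmorph1 normr1; rewrite big1_eq.
  under [RHS]eq_bigr do rewrite rmorph_prod normr_prod.
  rewrite exchange_big; apply: eq_bigr => l _ /=; rewrite /b.
  case: (e l) => m; rewrite ?NegzE -?exprz_inv -?exprnP -?prodfV -prodrXl; apply: eq_bigr => k _.
    by rewrite rmorphXn normrX.
  by rewrite rmorphXn normrX fmorphV normfV.
apply/eqP; rewrite gt_eqF // (bigD1 k0) //= (lt_le_trans (y := b k0 ^ e k0)) //.
  by have b1 := b_gt1 _ k0P; case: (e k0) k0P => [[|m]|] // _; rewrite -exprnP exprn_egt1.
rewrite ler_peMr ?exprz_ge0 ?(ltW (b_gt0 _)) //.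
by elim/big_ind: _ => // x y x1 y1; apply: mulr_ege1.
Qed.

(** * Existence of a unit that is small at all places but one *)

Variable w : 'I_n.+1 -> F.
Hypotheses (Ow : forall k, O (w k)).
Hypothesis w_free : forall c : 'I_n.+1 -> int,
  \sum_k (c k)%:~R * w k = 0 -> forall k, c k = 0.

Let lin (c : {ffun 'I_n.+1 -> int}) : F := \sum_k (c k)%:~R * w k.

Let O0 : O 0. Proof. by rewrite -(subrr 1); apply: OB. Qed.

Let OD x y : O x -> O y -> O (x + y).
Proof. by move=> Ox Oy; rewrite -[y]opprK -[- y]sub0r; do 2!apply: OB => //. Qed.

Let Oint (m : int) : O m%:~R.
Proof.
have Onat k : O k%:R by elim: k => // k IH; rewrite mulrSr; apply: OD.
case: m => k; first exact: Onat.
by rewrite NegzE mulrNz -sub0r; apply: OB => //; apply: Onat.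
Qed.

Let Olin c : O (lin c).
Proof. by rewrite /lin; elim/big_ind: _ => // k _; apply: OM (Oint _) (Ow k). Qed.

Let lin_inj : injective lin.
Proof.
move=> c d eqcd; apply/ffunP => k; apply/eqP; rewrite -subr_eq0; apply/eqP.
apply: (w_free (c := fun k => c k - d k)).
transitivity (lin c - lin d); last by rewrite eqcd subrr.
rewrite -sumrB; by apply: eq_bigr => i _; rewrite rmorphB mulrBl.
Qed.

(** A pigeonhole form of Minkowski's theorem on linear forms. The point is that [C] does not depend
    on [eps]: what the other places lose, the place [j] gains. *)
Lemma Dirichlet_approximation (j : 'I_n.+1) :
  exists C : nat, forall eps : R, 0 < eps -> exists c,
    [/\ lin c != 0, forall i, i != j -> `|sigma i (lin c)| < eps
      & \prod_i `|sigma i (lin c)| <= C%:R].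
Proof.
have [B BP] : exists B : nat, forall i, \sum_k `|sigma i (w k)| < B%:R :> R.
  exists (\max_i (Num.truncn (\sum_k `|sigma i (w k)|)).+1)%N => i.
  rewrite -truncn_lt_nat ?sumr_ge0 //; exact: leq_bigmax.
have B0 : 0 < B%:R :> R by apply: le_lt_trans (BP ord0); apply: sumr_ge0.
exists ((2 * B) ^ n.+1)%N => eps eps0.
(* Coefficients run from 0 to q^n, giving (q^n+1)^(n+1) elements. At each place but [j] the range of
   length 2Bq^n is cut into q^(n+1) pieces of length 2B/q < eps, in all (q^n)^(n+1) cells. The norm
   of a difference is then at most 2Bq^n (2B/q)^n = (2B)^(n+1). *)
pose q := (Num.truncn (2 * B%:R / eps)).+1.
have q_eps : 2 * B%:R / q%:R < eps.
  by rewrite ltr_pdivrMr ?ltr0n // [eps * _]mulrC -ltr_pdivrMr // truncnS_gt.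
have q0 : 0 < q%:R :> R by rewrite ltr0n.
pose x (c : {ffun 'I_n.+1 -> 'I_(q ^ n).+1}) := [ffun k => (c k : nat)%:Z].
have xB c i : `|sigma i (lin (x c))| < B%:R * q%:R ^+ n.
  rewrite rmorph_sum (le_lt_trans (ler_norm_sum _ _ _)) //.
  apply: le_lt_trans (_ : (\sum_k `|sigma i (w k)|) * q%:R ^+ n < _); last first.
    by rewrite ltr_pM2r ?exprn_gt0.
  rewrite mulr_suml; apply: ler_sum => k _; rewrite rmorphM normrM mulrC.
  apply: ler_wpM2l => //; rewrite ffunE rmorph_int normr_nat -natrX ler_nat.
  by rewrite -ltnS.
pose y c i := (sigma i (lin (x c)) + B%:R * q%:R ^+ n) * (q%:R / (2 * B%:R)).
have y0 c i : 0 <= y c i < (q ^ n.+1)%:R.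
  have := xB c i; rewrite ltr_norml => /andP[lo hi].
  rewrite /y mulr_ge0 ?divr_ge0 ?mulr_ge0 ?ltW //=; last by lra.
  have -> : (q ^ n.+1)%:R = 2 * (B%:R * q%:R ^+ n) * (q%:R / (2 * B%:R)) :> R.
    by rewrite natrX exprS; field; rewrite gt_eqF.
  by rewrite ltr_pM2r ?divr_gt0 ?mulr_gt0 //; lra.
have yt c i : (Num.truncn (y c i) < q ^ n.+1)%N by case/andP: (y0 c i) => ? ?; rewrite truncn_lt_nat.
pose col c := [ffun i : 'I_n => Ordinal (yt c (lift j i))].
have [|c [d [neq_cd /ffunP eqcol]]] := @pigeonhole _ _ col.
  rewrite !card_ffun !card_ord -expnM mulnC expnM.
  by rewrite ltn_exp2r.
have xB2 : lin (x c) - lin (x d) = lin [ffun k => (c k : nat)%:Z - (d k : nat)%:Z].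
  by rewrite /lin -sumrB; apply: eq_bigr => k _; rewrite !ffunE rmorphB mulrBl.
exists [ffun k => (c k : nat)%:Z - (d k : nat)%:Z]; rewrite -xB2.
have small i : i != j -> `|sigma i (lin (x c) - lin (x d))| < 2 * B%:R / q%:R.
  case: (unliftP j i) => [k ->|->]; last by rewrite eqxx.
  move=> _; have := congr1 val (eqcol k); rewrite !ffunE /= => eqt.
  have [y1 _] := andP (y0 c (lift j k)); have [y2 _] := andP (y0 d (lift j k)).
  have := truncn_eq_dist y1 y2 eqt; rewrite /y -mulrBl opprD addrACA subrr addr0 -rmorphB.
  rewrite normrM (@ger0_norm _ (q%:R / _)) ?divr_ge0 ?mulr_ge0 ?ltW //.
  by rewrite -ltr_pdivlMr ?divr_gt0 ?mulr_gt0 // mul1r invf_div.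
split.
- rewrite subr_eq0; apply: contra neq_cd => /eqP/lin_inj/ffunP eqx.
  by apply/eqP/ffunP => k; have := eqx k; rewrite !ffunE => -[] /val_inj.
- by move=> i /small /lt_trans; apply.
rewrite (bigD1_ord j) //= natrX natrM.
apply: (@le_trans _ _ (2 * (B%:R * q%:R ^+ n) * \prod_(i < n) (2 * B%:R / q%:R))).
  apply: ler_pM => //; first by apply: prodr_ge0.
    rewrite rmorphB (le_trans (ler_normB _ _)) // mulrDl mul1r.
    by rewrite lerD // ltW.
  by apply: ler_prod => i _; rewrite normr_ge0 ltW // small // eq_sym neq_lift.
rewrite prodr_const card_ord expr_div_n exprS.
rewrite (_ : _ * _ = 2 * B%:R * (2 * B%:R) ^+ n) //.
by field; rewrite expf_neq0 // gt_eqF.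
Qed.

(** Approximation yields arbitrarily long chains of elements of bounded norm, each smaller than the
    earlier ones at every place but [j]. Two members with coefficients congruent modulo a suitable
    integer divide each other in [O], and their quotient is the unit. *)
Lemma small_unit (j : 'I_n.+1) :
  exists2 u, O_unit u & forall i, i != j -> `|sigma i u| < 1.
Proof.
have [C approx] := Dirichlet_approximation j.
pose good c := lin c != 0 /\ \prod_i `|sigma i (lin c)| <= C%:R.
pose lt_off (c d : {ffun 'I_n.+1 -> int}) := [forall (i | i != j), `|sigma i (lin c)| < `|sigma i (lin d)|].
have chain m : exists s : seq {ffun 'I_n.+1 -> int},
  [/\ size s = m, forall c, c \in s -> good c & pairwise lt_off s].
  elim: m => [|m [s [ss sg sp]]]; first by exists [::].
  have [eps eps0 epsP] : exists2 eps : R, 0 < eps & forall c, c \in s -> forall i, eps <= `|sigma i (lin c)|.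
    elim: s sg {ss sp} => [|c s IH] sg; first by exists 1.
    have [|e e0 eP] := IH; first by move=> d ds; apply: sg; rewrite inE ds orbT.
    have [c0 _] := sg c (mem_head _ _).
    have [e1 e10 e1P] : exists2 e1 : R, 0 < e1 & forall i, e1 <= `|sigma i (lin c)|.
      exists (\big[Order.min/1]_i `|sigma i (lin c)|).
        by rewrite lt_bigmin ?ltr01 // => i _; rewrite normr_gt0 fmorph_eq0.
      by move=> i; apply: bigmin_le.
    exists (Order.min e e1); first by rewrite lt_min e0.
    move=> d /[!inE] /orP[/eqP->|/eP eP'] i; rewrite ge_min ?e1P ?orbT //.
    by rewrite eP'.
  have [c [c0 csmall cN]] := approx _ eps0.
  exists (c :: s); split; first by rewrite /= ss.
    by move=> d /[!inE] /orP[/eqP->|/sg].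
  rewrite /= sp andbT; apply/allP => d ds; apply/forall_inP => i /csmall /lt_le_trans; apply.
  exact: epsP.
(* Every nonzero integer of modulus at most [C] divides [W], so every good element divides [W] in
   [O]. If c = d modulo W, then c/d = 1 + ((c - d)/W)(W/d) lies in [O]; exchanging c and d gives the
   inverse. *)
pose W := C`!.
have W0 : (W%:Z != 0) by rewrite eqz_nat -lt0n fact_gt0.
have modW (m : int) : (`|(m %% W)%Z| < W)%N.
  by have := ltz_mod m W0; have := modz_ge0 m W0; lia.
pose col (c : {ffun 'I_n.+1 -> int}) := [ffun k => Ordinal (modW (c k))].
have [s [ss sg sp]] := chain #|{ffun 'I_n.+1 -> 'I_W}|.+1.
have W_div d : good d -> O (W%:R / lin d).
  case=> d0 dC; have [m Nm Om] := O_norm (Olin d) d0.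
  have m0 : m != 0 by have := norm_neq0 d0; rewrite Nm intr_eq0.
  have mC : (`|m| <= C)%N by move: dC; rewrite -normr_prod Nm -intr_norm -abszE -pmulrn ler_nat.
  have /dvdnP[k Wk] : (`|m| %| W)%N by rewrite dvdn_fact // absz_gt0 m0.
  have -> : W%:R / lin d = (k%:Z * sgz m)%:~R * (m%:~R / lin d).
    rewrite mulrA -rmorphM /= -mulrA -abszEsg -PoszM -Wk //.
  by apply: OM.
have ratio c d : good d -> col c = col d -> O (lin c / lin d).
  move=> gd /ffunP eqcol.
  pose e := [ffun k => ((c k - d k) %/ W)%Z].
  have -> : lin c / lin d = 1 + lin e * (W%:R / lin d).
    have -> : lin c = lin d + lin e * W%:R.
      rewrite /lin mulr_suml -big_split; apply: eq_bigr => k _ /=.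
      rewrite mulrAC -mulrDl pmulrn -rmorphM -rmorphD /= ffunE divzK ?subrKC //.
      have /(congr1 val) := eqcol k; rewrite !ffunE /= => eqk.
      rewrite -eqz_mod_dvd; apply/eqP.
      by have := modz_ge0 (c k) W0; have := modz_ge0 (d k) W0; lia.
    by rewrite mulrDl divff ?mulrA //; case: gd.
  by apply: OD => //; apply: OM => //; apply: W_div.
have [a [b [lt_ab eqcol]]] : exists a b : nat, (a < b < size s)%N /\ col (nth [ffun=> 0] s a) = col (nth [ffun=> 0] s b).
  have [|a [b [neq_ab eqcol]]] := @pigeonhole 'I_(size s) _ (fun i => col (nth [ffun=> 0] s i)).
    by rewrite card_ord ss.
  have [ltab|ltba|/val_inj eqab] := ltngtP a b; last by rewrite eqab eqxx in neq_ab.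
    by exists a, b; rewrite ltab ltn_ord.
  by exists b, a; rewrite ltba ltn_ord.
have [lt_a lt_b] : (a < size s)%N /\ (b < size s)%N by lia.
move: eqcol; set c := nth _ s a; set d := nth _ s b => eqcol.
have [gc gd] : good c /\ good d by split; apply/sg/mem_nth.
have [c0 _] := gc; have [d0 _] := gd.
exists (lin c / lin d).
  split; first by rewrite mulf_neq0 ?invr_eq0.
    exact: ratio.
  by rewrite invf_div; apply: ratio.
have /forall_inP lt_cd : lt_off c d by move/(pairwiseP [ffun=> 0]): sp; apply => //; case/andP: lt_ab.
move=> i /lt_cd; rewrite rmorphM fmorphV normrM normfV => ?.
by rewrite ltr_pdivrMr ?mul1r // normr_gt0 fmorph_eq0.
Qed.

End Embeddings.

(** * Unit rank of a totally real number field *)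

Lemma map_poly_intr (R S : nzRingType) (iota : {rmorphism R -> S}) (p : {poly int}) :
  map_poly iota (map_poly intr p) = map_poly intr p.
Proof. by rewrite -map_poly_comp; apply: eq_map_poly => m /=; rewrite rmorph_int. Qed.

(** The gcd of [p] and [q] is [p] up to a scalar or a constant, and a nonzero constant has no root.
    The criterion does not mention [a], so relations transfer between roots of [p] in different
    fields. *)
Lemma irreducible_root_dvdp (F K : fieldType) (iota : {rmorphism F -> K}) (p q : {poly F}) (a : K) :
  irreducible_poly p -> root (map_poly iota p) a ->
  root (map_poly iota q) a = (p %| q).
Proof.
move=> [_ irr_p] pa; apply/idP/idP => [qa|/dvdpP[u ->]]; last first.
  by rewrite rmorphM rootM pa orbT.
have ga : root (map_poly iota (gcdp p q)) a by rewrite gcdp_map root_gcd pa.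
rewrite -(eqp_dvdl _ (irr_p _ _ (dvdp_gcdl p q))) ?dvdp_gcdr //.
apply: contraTneq ga => /eqP; rewrite size_poly_eq1 => /eqpP[[c d] /= /andP[c0 d0]].
rewrite alg_polyC => /(congr1 (map_poly iota)); rewrite map_polyZ map_polyC /= => E.
apply/negP => /rootP gz; have := congr1 (horner^~ a) E.
by rewrite hornerZ gz mulr0 hornerC => /eqP; rewrite eq_sym fmorph_eq0 (negPf d0).
Qed.

Section PolynomialNorm.

Variables (F K : fieldType) (iota : {rmorphism F -> K}) (n : nat).
Variables (f : {poly F}) (r : 'I_n -> K).
Hypotheses (size_f : size f = n.+1) (r_inj : injective r).
Hypothesis fr : forall i, root (map_poly iota f) (r i).

(* The matrix of multiplication by q in F[X]/(f) is diagonalized by the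
   Vandermonde matrix of the roots. *)
Lemma prod_horner_roots_rational (q : {poly F}) :
  exists c, \prod_i (map_poly iota q).[r i] = iota c.
Proof.
pose A := \matrix_(i < n, j < n) (('X^i * q) %% f)`_j.
pose V := Vandermonde n (\row_j r j).
have detV : \det V != 0.
  rewrite det_Vandermonde; apply/prodf_neq0 => i _; apply/prodf_neq0 => j ij.
  by rewrite !mxE subr_eq0 (inj_eq r_inj) -val_eqE gtn_eqF.
have AV : map_mx iota A *m V = V *m diag_mx (\row_i (map_poly iota q).[r i]).
  apply/matrixP => i j; rewrite mul_mx_diag !mxE.
  under eq_bigr do rewrite !mxE.
  have := horner_mod (map_poly iota ('X^i * q)) (fr j).
  rewrite -map_modp rmorphM /= map_polyXn hornerM hornerXn => <-.
  rewrite (@horner_coef_wide _ n) ?size_map_poly.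
    by apply: eq_bigr => k _; rewrite coef_map.
  by rewrite -ltnS -size_f ltn_modp -size_poly_eq0 size_f.
exists (\det A); apply: (mulIf detV).
rewrite -det_map_mx -det_mulmx AV det_mulmx det_diag mulrC.
by congr (_ * _); apply: eq_bigr => i _; rewrite mxE.
Qed.

End PolynomialNorm.

(** The minimal polynomial over the rationals of an algebraic integer has integer coefficients;
    being monic, it witnesses integrality back in [F], since [sigma] is injective. *)
Lemma integral_algR (F : fieldType) (sigma : {rmorphism F -> algR}) (x : F) :
  integralOver (intr : int -> F) x <-> algRval (sigma x) \in Aint.
Proof.
split=> [[p monp px]|].
  apply: (@root_monic_Aint (map_poly intr p)); last by apply/polyOverP => i; rewrite coef_map /= intr_int.
    by rewrite -(map_poly_intr (algRval \o sigma)) fmorph_root.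
  exact: monic_map.
move/floorpK; set p := map_poly Num.floor _ => pE.
exists p; last by rewrite -(fmorph_root (algRval \o sigma)) map_poly_intr pE root_minCpoly.
have := minCpoly_monic (algRval (sigma x)); rewrite -pE.
rewrite !monicE lead_coef_map_inj //; last exact: intr_inj.
by rewrite -[X in _ == X -> _]/(1%:~R) eqr_int.
Qed.

(** The norm is a rational algebraic integer, hence an integer. Under [sigma ord0], the quotient of
    the norm by [x] becomes the product of the other conjugates, which is again integral. *)
Lemma integral_norm (F : fieldType) (n : nat) (sigma : 'I_n.+1 -> {rmorphism F -> algR}) :
  (forall x, exists c, \prod_i sigma i x = ratr c) ->
  forall x : F, integralOver (intr : int -> F) x -> x != 0 ->
  exists2 m : int, \prod_i sigma i x = m%:~R &
    integralOver (intr : int -> F) (m%:~R / x).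
Proof.
move=> rat_norm x intx x0.
have Ax i : algRval (sigma i x) \in Aint by apply/integral_algR.
have : algRval (\prod_i sigma i x) \is a Num.int.
  apply: Cint_rat_Aint; last by rewrite rmorph_prod; apply: rpred_prod.
  by have [c ->] := rat_norm x; rewrite fmorph_rat Crat_rat.
case/intrP => m Nm; have {}Nm : \prod_i sigma i x = m%:~R.
  by apply: val_inj; rewrite /= Nm rmorph_int.
exists m => //; apply/(integral_algR (sigma ord0)).
rewrite rmorphM fmorphV rmorph_int -Nm (bigD1 ord0) //= mulrAC mulfV ?fmorph_eq0 // mul1r.
by rewrite rmorph_prod; apply: rpred_prod.
Qed.

Section PrimitiveElement.

Variables (F : fieldType) (L : fieldExtType F) (alpha : L) (f : {poly F}).
Hypotheses (irr_f : irreducible_poly f) (f_alpha : root (map_poly (in_alg L) f) alpha).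

Lemma Fadjoin1P (x : L) : x \in <<1; alpha>>%VS ->
  exists q : {poly F}, x == (map_poly (in_alg L) q).[alpha].
Proof. by case/Fadjoin_polyP=> _ /polyOver1P[q ->] ->; exists q. Qed.

Lemma dim_Fadjoin1 : \dim <<1; alpha>> = (size f).-1.
Proof.
rewrite dim_Fadjoin dimv1 muln1 -[adjoin_degree _ _]/(_.+1.-1) -size_minPoly; congr _.-1.
have /polyOver1P[m mE] := minPolyOver 1 alpha.
have fm : f %| m by rewrite -(irreducible_root_dvdp _ irr_f f_alpha) -mE root_minPoly.
have mf : m %| f.
  rewrite -(dvdp_map (in_alg L)) -mE minPoly_dvdp //.
  by apply/polyOver1P; exists f.
rewrite mE size_map_poly; apply: eqp_size.
by rewrite /eqp mf.
Qed.

Lemma embedding_exists (S : fieldType) (iota : {rmorphism F -> S}) (s : S) :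
  root (map_poly iota f) s ->
  exists sigma : {rmorphism subvs_of <<1; alpha>>%AS -> S},
    forall x (q : {poly F}), vsval x = (map_poly (in_alg L) q).[alpha] ->
      sigma x = (map_poly iota q).[s].
Proof.
move=> fs.
pose rep (x : subvs_of <<1; alpha>>%AS) := xchoose (Fadjoin1P (subvsP x)).
have repP x : vsval x = (map_poly (in_alg L) (rep x)).[alpha].
  exact: eqP (xchooseP (Fadjoin1P (subvsP x))).
pose h x := (map_poly iota (rep x)).[s].
(* Independence of the chosen representative: [alpha] and [s] are zeros of exactly the multiples of
   [f]. Additivity and multiplicativity follow by choosing convenient representatives. *)
have hE x q : vsval x = (map_poly (in_alg L) q).[alpha] -> h x = (map_poly iota q).[s].
  move=> xq; apply/eqP; rewrite -subr_eq0 -hornerN -hornerD -rmorphB -rootE.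
  rewrite (irreducible_root_dvdp _ irr_f fs) -(irreducible_root_dvdp _ irr_f f_alpha).
  by rewrite rootE rmorphB hornerD hornerN -repP xq subrr.
have hB : zmod_morphism h.
  move=> x y; rewrite (hE _ (rep x - rep y)) ?rmorphB ?hornerD ?hornerN //=.
  by rewrite -!repP.
have hM : monoid_morphism h.
  split=> [|x y]; first by rewrite (hE _ 1) ?rmorph1 ?hornerC // algid1.
  by rewrite (hE _ (rep x * rep y)) ?rmorphM ?hornerM //= -!repP.
pose hBm := GRing.isZmodMorphism.Build _ _ h hB.
pose hMm := GRing.isMonoidMorphism.Build _ _ h hM.
pose sigma : {rmorphism subvs_of <<1; alpha>>%AS -> S} := HB.pack h hBm hMm.
by exists sigma.
Qed.

End PrimitiveElement.

Section UnitRank.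

Variables (n : nat) (f : {poly int}) (r : 'I_n.+1 -> algR).
Hypotheses (monic_f : f \is monic) (size_f : size f = n.+2).
Hypothesis irr_f : irreducible_poly (map_poly intr f : {poly rat}).
Hypotheses (r_inj : injective r) (fr : forall i, root (map_poly intr f) (r i)).

Theorem totally_real_unit_rank (L : fieldExtType rat) (alpha : L) :
  root (map_poly intr f) alpha -> unit_group_rank <<1; alpha>>%AS n.
Proof.
move=> f_alpha; pose K := subvs_of <<1; alpha>>%AS.
have f_alpha' : root (map_poly (in_alg L) (map_poly intr f)) alpha by rewrite map_poly_intr.
have fr' i : root (map_poly ratr (map_poly intr f)) (r i) by rewrite map_poly_intr.
have [sigma sigmaE] : exists sigma : 'I_n.+1 -> {rmorphism K -> algR},
    forall i x (q : {poly rat}), vsval x = (map_poly (in_alg L) q).[alpha] ->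
      sigma i x = (map_poly ratr q).[r i].
  exact: fin_all_exists (fun i => embedding_exists irr_f f_alpha' (fr' i)).
pose O (x : K) := integralOver (intr : int -> K) x.
have O1 : O 1 by apply: integral1.
have OB x y : O x -> O y -> O (x - y) by apply: integral_sub.
have OM x y : O x -> O y -> O (x * y) by apply: integral_mul.
have ON : forall x, O x -> x != 0 -> exists2 m : int, \prod_i sigma i x = m%:~R & O (m%:~R / x).
  apply: integral_norm => x.
  have [q /eqP xq] := Fadjoin1P (subvsP x).
  have [c Ec] := prod_horner_roots_rational (etrans (size_map_inj_poly (intr_inj) (rmorph0 _) f) size_f) r_inj fr' q.
  exists c; rewrite -Ec; apply: eq_bigr => i _; exact: sigmaE.
have intL (x : K) : integralOver (intr : int -> L) (vsval x) <-> O x.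
  by split=> -[p monp px]; exists p => //; move: px; rewrite -(map_poly_intr (vsval : {rmorphism K -> L})) fmorph_root.
have unitL (x : L) : is_integer_unit <<1; alpha>>%AS x <->
    exists2 v : K, O_unit O v & x = vsval v.
  split=> [[[xK Ox] [y [yK Oy] xy1]]|[v [v0 Ov OV] ->]].
    exists (vsproj _ x); last by rewrite vsprojK.
    have xy : vsproj <<1; alpha>>%AS x * vsproj <<1; alpha>>%AS y = 1.
      by apply: val_inj; rewrite rmorphM /= !vsprojK // xy1 algid1.
    have x0 : vsproj <<1; alpha>>%AS x != 0.
      by apply: contra_eq_neq xy => ->; rewrite mul0r eq_sym oner_eq0.
    split=> //; first by apply/intL; rewrite vsprojK.
    rewrite -[_^-1]mulr1 -xy mulKf //; apply/intL; rewrite vsprojK //.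
  split; first by split; [exact: subvsP | apply/intL].
  exists (vsval v^-1); first by split; [exact: subvsP | apply/intL].
  by rewrite -rmorphM divff // rmorph1.
split.
  pose alphaK : K := vsproj _ alpha.
  have alphaE : vsval alphaK = alpha by rewrite vsprojK // memv_adjoin.
  pose w (k : 'I_n.+1) := alphaK ^+ k.
  have Oalpha : O alphaK by apply/intL; rewrite alphaE; exists f.
  have Ow k : O (w k).
    by rewrite /w; elim: (k : nat) => [|m IH]; rewrite ?expr0 // exprS; apply: OM.
  have w_free (c : 'I_n.+1 -> int) : \sum_k (c k)%:~R * w k = 0 -> forall k, c k = 0.
    (* A relation among the powers 0 to n of [alpha] is a polynomial of degree at most n divisible
       by [f], whose degree is n+1. *)
    move=> cw k; pose q : {poly int} := \poly_(i < n.+1) c (inord i).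
    have q0 : q = 0.
      have fq : map_poly intr f %| (map_poly intr q : {poly rat}).
        rewrite -(irreducible_root_dvdp _ irr_f f_alpha') map_poly_intr rootE.
        rewrite (@horner_coef_wide _ n.+1) ?(leq_trans (size_poly _ _)) ?size_poly //.
        apply/eqP; transitivity (vsval (\sum_k (c k)%:~R * w k)); last by rewrite cw rmorph0.
        rewrite rmorph_sum; apply: eq_bigr => i _; rewrite coef_map coef_poly ltn_ord inord_val.
        by rewrite rmorphM rmorph_int rmorphXn /= alphaE.
      have size_intr (p : {poly int}) : size (map_poly intr p : {poly rat}) = size p.
        by apply: size_map_inj_poly; [exact: intr_inj|].
      apply: contraTeq fq => q0; apply/negP => /dvdp_leq.
      by rewrite -size_poly_gt0 !size_intr size_poly_gt0 q0 size_f ltnNge size_poly => /(_ isT).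
    by have /polyP/(_ k) := q0; rewrite coef_poly ltn_ord inord_val coef0.
  have [v [vP v_small]] : exists v : 'I_n -> K, (forall k, O_unit O (v k)) /\
      (forall k i, i != lift ord_max k -> `|sigma i (v k)| < 1).
    have : forall k : 'I_n, exists v, O_unit O v /\ forall i, i != lift ord_max k -> `|sigma i v| < 1.
      move=> k; have [v Uv vlt] := small_unit O1 OB OM ON Ow w_free (lift ord_max k).
      by exists v.
    case/fin_all_exists => v vP; exists v.
    by split=> k; have [] := vP k.
  exists (fun k => vsval (v k)) => [k|e]; first by apply/unitL; exists (v k).
  move=> ve k; apply: (off_diagonal_units_independent ON vP v_small) => {k}.
  apply: val_inj; rewrite [RHS]algid1 -[RHS]ve rmorph_prod; apply: eq_bigr => k _.
  by rewrite [LHS](fmorphXz vsval).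
move=> k u Uu indep; rewrite leqNgt; apply/negP => ltnk.
move: u Uu indep; rewrite -(subnKC ltnk) => u Uu indep.
have uE (i : 'I_n.+1) : exists v, O_unit O v /\ u (lshift (k - n.+1) i) = vsval v.
  by have /unitL[v Uv uv] := Uu (lshift _ i); exists v.
have [v vP] := fin_all_exists uE.
have [e ve1 [j ej]] := O_units_dependent O1 OB OM ON (fun i => (vP i).1).
pose e' (i : 'I_(n.+1 + (k - n.+1))) := if split i is inl i1 then e i1 else 0.
have e'l i : e' (lshift _ i) = e i by rewrite /e' -[lshift _ i]/(unsplit (inl i)) unsplitK.
have e'r i : e' (rshift _ i) = 0 by rewrite /e' -[rshift _ i]/(unsplit (inr i)) unsplitK.
have /indep/(_ (lshift _ j)) : \prod_i u i ^ e' i = 1.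
  rewrite big_split_ord /= [X in _ * X]big1 => [|i _]; last by rewrite e'r.
  rewrite mulr1; transitivity (vsval (\prod_i v i ^ e i)); last by rewrite ve1 /= algid1.
  rewrite rmorph_prod; apply: eq_bigr => i _.
  by rewrite e'l (vP i).2 [RHS](fmorphXz vsval).
by rewrite e'l; apply/eqP.
Qed.

End UnitRank.

(** * Irreducibility of g_n *)

Lemma g_overE (K : nzRingType) n t :
  g_over K n t = 'X^n - (t + 3)%:~R *: 'X^(n.-1) + t%:~R *: 'X + 1.
Proof.
by rewrite /g_over /g !rmorphD rmorphN /= !map_polyZ /= !map_polyXn map_polyX rmorph1 !rmorphD.
Qed.

Lemma horner_g (K : comNzRingType) n t (x : K) :
  (g_over K n t).[x] = x ^+ n - (t%:~R + 3) * x ^+ n.-1 + t%:~R * x + 1.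
Proof. by rewrite g_overE !hornerE ?hornerXn ?rmorphD. Qed.

Lemma size_g_tail (R : nzRingType) n (t : int) : (4 <= n)%N ->
  (size (- ((t + 3)%:~R *: 'X^(n.-1)) + t%:~R *: 'X + 1 : {poly R})%R < n.+1)%N.
Proof.
move=> hn; rewrite ltnS; have [n0 n1] : (0 < n)%N /\ (1 < n)%N by lia.
apply: leq_trans (size_polyD _ _) _; rewrite geq_max size_poly1 n0 andbT.
apply: leq_trans (size_polyD _ _) _; rewrite geq_max size_polyN; apply/andP; split.
  by rewrite (leq_trans (size_scale_leq _ _)) // size_polyXn prednK.
by rewrite (leq_trans (size_scale_leq _ _)) // size_polyX.
Qed.

Lemma size_g_over (R : nzRingType) n t : (4 <= n)%N -> size (g_over R n t) = n.+1.
Proof.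
by move=> hn; rewrite g_overE -!addrA size_polyDl size_polyXn // addrA size_g_tail.
Qed.

Lemma monic_g_over (R : nzRingType) n t : (4 <= n)%N -> g_over R n t \is monic.
Proof.
move=> hn; rewrite monicE g_overE -!addrA lead_coefDl ?lead_coefXn //.
by rewrite size_polyXn addrA size_g_tail.
Qed.

(** The moduli of the roots multiply to that of [p.[0]], so they cannot all be below 1. *)
Lemma large_root (p : {poly algC}) : (1 < size p)%N -> `|lead_coef p| = 1 ->
  1 <= `|p.[0]| -> exists2 z, root p z & 1 <= `|z|.
Proof.
move=> size_p lead_p p0; have [rs pE] := closed_field_poly_normal p.
have [|] := boolP (has (fun z => 1 <= `|z|) rs).
  case/hasP=> z zrs z1; exists z => //.
  by rewrite pE rootZ -?normr_gt0 ?lead_p ?ltr01 // root_prod_XsubC.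
rewrite -all_predC => /allP small.
suff: `|p.[0]| < 1 by rewrite real_ltNge ?p0 ?num_real.
rewrite pE hornerZ normrM lead_p mul1r horner_prod normr_prod.
have : (0 < size rs)%N.
  move: size_p; rewrite pE size_scale ?size_prod_XsubC // -normr_gt0 lead_p ltr01 //.
have lt1 z : z \in rs -> `|('X - z%:P).[0]| < 1.
  by move/small; rewrite /= hornerXsubC sub0r normrN real_ltNge ?num_real.
case: rs lt1 {pE small} => // z rs lt1 _; rewrite big_cons.
apply: le_lt_trans (lt1 z (mem_head _ _)); rewrite ler_piMr // big_seq_cond.
by apply: prodr_ile1 => y /andP[ys _]; rewrite normr_ge0 ltW // lt1 // inE ys orbT.
Qed.

Section OneLargeRoot.

Variables (n : nat) (t : int).
Hypotheses (hn : (4 <= n)%N) (ht : 4 <= t).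
Local Notation g := (g_over algC n t).
Let T : algC := t%:~R.
Let T4 : 4 <= T. Proof. by rewrite /T -[4]/(4%:~R) ler_int. Qed.
Let T0 : 0 <= T. Proof. exact: le_trans T4. Qed.

(** From z^(n-1) (T + 3 - z) = T z + 1 and |z| >= 1 one gets |T + 3 - z| <= T + 1, and the triangle
    inequality concludes. *)
Lemma large_root_ge2 z : root g z -> 1 <= `|z| -> 2 <= `|z|.
Proof.
move=> /rootP; rewrite horner_g -/T => gz z1.
have z0 : z != 0 by rewrite -normr_gt0 (lt_le_trans ltr01).
have E : z ^+ n.-1 * (T + 3 - z) = T * z + 1.
  have n0 : (0 < n)%N by lia.
  apply/eqP; rewrite -subr_eq0 -oppr_eq0 -[X in _ == X]gz -[in X in _ == X](prednK n0) exprS; apply/eqP.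
  ring.
have le : `|T + 3 - z| <= T + 1.
  have zn : `|z| <= `|z| ^+ n.-1 by rewrite ler_eXnr // ; lia.
  have z0' : 0 < `|z| by rewrite normr_gt0.
  rewrite -(ler_pM2l z0'); apply: (@le_trans _ _ (`|z| ^+ n.-1 * `|T + 3 - z|)).
    by rewrite ler_wpM2r.
  rewrite -normrX -normrM E (le_trans (ler_normD _ _)) // normrM normr1 (ger0_norm T0).
  by rewrite mulrDr mulr1 mulrC lerD2l.
have := ler_normD (T + 3 - z) z; rewrite subrK ger0_norm ?addr_ge0 //.
move=> /le_trans/(_ (lerD le (lexx _))).
by rewrite -addrA lerD2l (_ : 3 = 1 + 2) ?lerD2l // -natrD.
Qed.

(** The divided difference (x^m - y^m)/(x - y), defined also at x = y, where it is the derivative.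
    One estimate thus serves both uniqueness and simplicity of the large root. *)
Let S m (x y : algC) := \sum_(i < m) x ^+ (m.-1 - i) * y ^+ i.

Let S_le m (x y : algC) : `|x| <= 2^-1 -> `|y| <= 2^-1 -> `|S m.+1 x y| <= m.+1%:R / 2 ^+ m.
Proof.
move=> x2 y2; rewrite (le_trans (ler_norm_sum _ _ _)) //.
rewrite mulr_natl -[X in _ *+ X]card_ord -sumr_const; apply: ler_sum => i _.
rewrite normrM !normrX -exprVn /= -[in leRHS](subnK (ltn_ord i : (i <= m)%N)) exprD.
by apply: ler_pM; rewrite ?exprn_ge0 // lerXn2r ?nnegrE ?invr_ge0.
Qed.

Let S_neq (x y : algC) : `|x| <= 2^-1 -> `|y| <= 2^-1 -> T * S n.-1 x y + S n x y != T + 3.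
Proof.
move=> x2 y2; have [m nE] : exists m, n = m.+4 by exists (n - 4)%N; lia.
have e2 : (m.+1 <= 2 ^ m)%N by rewrite ltn_expl.
have b1 : `|S n.-1 x y| <= 1.
  rewrite nE (le_trans (S_le _ x2 y2)) // ler_pdivrMr ?exprn_gt0 // mul1r -natrX ler_nat !expnS; lia.
have b2 : `|S n x y| <= 1.
  rewrite nE (le_trans (S_le _ x2 y2)) // ler_pdivrMr ?exprn_gt0 // mul1r -natrX ler_nat !expnS; lia.
apply/eqP => /(congr1 Num.norm)/eqP; rewrite lt_eqF //.
rewrite (ger0_norm (addr_ge0 T0 _)) // (le_lt_trans (ler_normD _ _)) //.
apply: (@le_lt_trans _ _ (T + 1)).
  by apply: lerD b2; rewrite normrM (ger0_norm T0) ler_piMr.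
by rewrite ltrD2l -[1]/(1%:R) ltr_nat.
Qed.

Let inv_le z : root g z -> 1 <= `|z| -> z != 0 /\ `|z^-1| <= 2^-1.
Proof.
move=> gz z1; have z2 := large_root_ge2 gz z1.
have z0 : 0 < `|z| by apply: lt_le_trans z2.
by split; [rewrite -normr_gt0 | rewrite normfV lef_pV2 ?posrE].
Qed.

(* The reciprocals of the roots are the zeros of 1 - (T+3)x + Tx^(n-1) + x^n,
   whose divided differences do not vanish on the disc of radius 1/2. *)
Lemma large_root_unique z w : root g z -> root g w -> 1 <= `|z| -> 1 <= `|w| -> z = w.
Proof.
move=> gz gw z1 w1; have [z0 z2] := inv_le gz z1; have [w0 w2] := inv_le gw w1.
have recip u : root g u -> u != 0 -> (T + 3) * u^-1 = 1 + T * u^-1 ^+ n.-1 + u^-1 ^+ n.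
  move=> /rootP; rewrite horner_g -/T => gu u0.
  have [m nE] : exists m, n = m.+1 by exists n.-1; exact: esym (ltn_predK hn).
  have um : u ^+ m != 0 by rewrite expf_neq0.
  apply/eqP; rewrite -subr_eq0; apply/eqP/(mulfI (x := u ^+ n)); first by rewrite expf_neq0.
  rewrite mulr0 -[RHS]oppr0 -gu nE /= !exprVn !exprS; field.
  by rewrite um u0.
apply/eqP; rewrite -(inj_eq invr_inj); apply: contraT => neq_zw.
have := S_neq z2 w2; rewrite -subr_eq0 in neq_zw.
rewrite -(inj_eq (mulfI neq_zw)) mulrDr mulrCA -!subrXX.
rewrite [_ * (T + 3)]mulrC [(T + 3) * _]mulrBr (recip _ gz z0) (recip _ gw w0).
case/eqP; ring.
Qed.

(** At a multiple root n g(z) - z g'(z) vanishes. This is z^(n-1) times T S_(n-1) + S_n - (T + 3)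
    taken at x = y = 1/z, which [S_neq] excludes. *)
Lemma large_root_simple z : root g z -> 1 <= `|z| -> ~~ root g^`() z.
Proof.
move=> gz z1; have [z0 z2] := inv_le gz z1.
have SE m : S m z^-1 z^-1 = m%:R * z^-1 ^+ m.-1.
  rewrite /S mulr_natl -[X in _ *+ X]card_ord -sumr_const; apply: eq_bigr => i _.
  by rewrite -exprD subnK //; have := ltn_ord i; lia.
apply: contra (S_neq z2 z2) => /rootP dz; move/rootP: gz; rewrite horner_g -/T => gz.
have [m nE] : exists m, n = m.+2 by exists n.-2; lia.
have zm : z ^+ m != 0 by rewrite expf_neq0.
have {}dz : (m%:R + 2) * (z * z ^+ m) - (T + 3) * ((m%:R + 1) * z ^+ m) + T = 0.
  have gE : g = 'X^n - (T + 3) *: 'X^(n.-1) + T *: 'X + 1 by rewrite g_overE rmorphD.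
  rewrite -[RHS]dz gE !derivE !hornerE ?hornerXn !hornerMn ?hornerXn nE /=.
  rewrite exprS -[_ *+ m.+2]mulr_natl -[_ *+ m.+1]mulr_natl -!natr1; ring.
rewrite nE /= !SE !exprVn -subr_eq0 /= -!natr1; apply/eqP/(mulfI (x := z ^+ m.+1)); first by rewrite expf_neq0.
move: gz; rewrite nE /= => gz.
transitivity ((m%:R + 2) * (z ^+ m.+2 - (T + 3) * z ^+ m.+1 + T * z + 1) -
  z * ((m%:R + 2) * (z * z ^+ m) - (T + 3) * ((m%:R + 1) * z ^+ m) + T)).
  by rewrite !exprS; field; rewrite zm z0.
by rewrite gz dz !mulr0 subrr.
Qed.

End OneLargeRoot.

Lemma norm_int_unit (a b : int) : a * b = 1 -> `|a%:~R : algC| = 1.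
Proof.
move=> /(congr1 absz)/eqP; rewrite abszM muln_eq1 => /andP[/eqP a1 _].
by rewrite -intr_norm -abszE a1.
Qed.

Theorem irreducible_g n t : (4 <= n)%N -> 4 <= t -> irreducible_poly (g_over rat n t).
Proof.
move=> hn ht; split=> [|q sq qg]; first by rewrite size_g_over; lia.
(* Gauss's lemma: over the integers both the leading coefficients and the values at 0 of the two
   factors are units. *)
have [p [a a0 qE] [h gE]] := dvdpP_rat_int qg.
have size_intr (u : {poly int}) : size (map_poly intr u : {poly algC}) = size u.
  by apply: size_map_inj_poly; [exact: intr_inj|].
have lead_ph : lead_coef p * lead_coef h = 1.
  rewrite -lead_coefM -gE; apply: (@intr_inj algC); rewrite -lead_coef_map_inj //; last exact: intr_inj.
  exact: monicP (monic_g_over _ _ hn).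
have ph0 : p.[0] * h.[0] = 1.
  rewrite -hornerM -gE /g; have -> : n = (n - 2).+2 by lia.
  by rewrite !hornerE ?hornerXn /= !exprS !mul0r mulr0 subr0 add0r.
have big (u v : {poly int}) : u * v = g n t -> lead_coef u * lead_coef v = 1 -> u.[0] * v.[0] = 1 ->
    (1 < size u)%N -> exists z, [/\ root (map_poly intr u) z, 1 <= `|z| & root (g_over algC n t) z].
  move=> uv luv uv0 su; have [|||z zu z1] := @large_root (map_poly intr u).
  - by rewrite size_intr.
  - by rewrite lead_coef_map_inj ?(norm_int_unit luv) //; exact: intr_inj.
  - by rewrite -[0]/(0%:~R) horner_map (norm_int_unit uv0).
  by exists z; split=> //; rewrite /g_over -uv rmorphM rootM zu.
have sp : (1 < size p)%N.
  have sqp : size q = size p.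
    by rewrite qE size_scale // size_map_inj_poly //; exact: intr_inj.
  have : size p != 0%N by rewrite size_poly_eq0 -lead_coef_eq0; apply: contra_eq_neq lead_ph => ->; rewrite mul0r.
  by rewrite -sqp in sq *; lia.
(* If both factors were nonconstant, each would have a large root; by uniqueness the two coincide
   and form a multiple root of [g]. *)
have [sh|sh] := leqP (size h) 1; last first.
  have [z [pz z1 gz]] := big p h (esym gE) lead_ph ph0 sp.
  have [|||w [hw w1 gw]] := big h p _ _ _ sh; rewrite 1?mulrC //.
  have := large_root_simple hn ht gz z1; rewrite /g_over gE rmorphM derivM rootE hornerD !hornerM.
  by rewrite {2}(large_root_unique hn ht gz gw z1 w1) (rootP pz) (rootP hw) mul0r mulr0 addr0 eqxx.
rewrite qE /g_over gE rmorphM /= (size1_polyC sh) map_polyC /= mulrC mul_polyC.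
have h0 : (h`_0)%:~R != 0 :> rat.
  by rewrite intr_eq0; apply: contra_eq_neq ph0 => h0; rewrite !horner_coef0 h0 mulr0.
by rewrite (eqp_trans (eqp_scale _ a0)) // eqp_sym eqp_scale.
Qed.

(** * Roots, resolvent and subfields of g_4 *)

Lemma strict_ivt (R : rcfType) (p : {poly R}) (a b : R) : a < b -> p.[a] * p.[b] < 0 ->
  exists2 x, a < x < b & root p x.
Proof.
move=> ltab pab.
wlog: p pab / p.[a] < 0 => [IH|pa].
  have [/IH-/(_ pab)//|pa|pa] := ltgtP p.[a] 0; last by rewrite pa mul0r ltxx in pab.
  have [||x xab] := IH (- p); rewrite ?hornerN ?mulrNN ?oppr_lt0 //.
  by rewrite rootN; exists x.
have pb : 0 < p.[b] by rewrite nmulr_rlt0 in pab.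
have [|x /andP[ax xb] px] := @poly_ivt _ p a b (ltW ltab); first by rewrite !ltW.
exists x => //; rewrite !lt_neqAle ax xb !andbT.
apply/andP; split; first by apply: contraTneq px => <-; rewrite rootE lt_eqF.
by apply: contraTneq px => ->; rewrite rootE gt_eqF.
Qed.

Lemma real_roots_g4 (t : int) : 4 <= t ->
  exists2 r : 'I_4 -> algR, injective r & forall i, root (g_over algR 4 t) (r i).
Proof.
move=> ht; have T4 : 4 <= t%:~R :> algR by rewrite -[4]/(4%:~R) ler_int.
pose g x : algR := x ^+ 4 - (t%:~R + 3) * x ^+ 3 + t%:~R * x + 1.
have gE x : (g_over algR 4 t).[x] = g x by rewrite horner_g.
have gm1 : 0 < g (-1) by rewrite /g; lra.
have gh : g (- (1 / 2)) < 0 by rewrite /g; lra.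
have g0 : 0 < g 0 by rewrite /g; lra.
have g1 : g 1 < 0 by rewrite /g; lra.
have gT : 0 < g (t%:~R + 3) by rewrite /g -exprS subrr; nra.
have root_in a b : a < b -> g a * g b < 0 -> exists2 x, a < x < b & root (g_over algR 4 t) x.
  by move=> ab gab; apply: strict_ivt => //; rewrite !gE.
have [||x1 /andP[? ?] r1] := root_in (-1) (- (1 / 2)); [lra | by rewrite pmulr_rlt0 |].
have [||x2 /andP[? ?] r2] := root_in (- (1 / 2)) 0; [lra | by rewrite nmulr_rlt0 |].
have [||x3 /andP[? ?] r3] := root_in 0 1; [lra | by rewrite pmulr_rlt0 |].
have [||x4 /andP[? ?] r4] := root_in 1 (t%:~R + 3); [lra | by rewrite nmulr_rlt0 |].
pose s := [tuple x1; x2; x3; x4]; exists (tnth s).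
  apply/tuple_uniqP/lt_sorted_uniq => /=; apply/and4P; split=> //; lra.
by move=> i; have /(allP (_ : all _ s)) := mem_tnth i s; apply; rewrite /= r1 r2 r3 r4.
Qed.

Lemma g4_roots_real (t : int) z : 4 <= t -> root (g_over algC 4 t) z -> z \is Num.real.
Proof.
move=> ht gz; have [r r_inj gr] := real_roots_g4 ht.
pose rs := [seq algRval (r i) | i : 'I_4].
have urs : uniq rs by rewrite map_inj_uniq ?enum_uniq // => i j /val_inj/r_inj.
have ars : all (root (g_over algC 4 t)) rs.
  by apply/allP => _ /mapP[i _ ->]; rewrite /g_over -(map_poly_intr (algRval : {rmorphism algR -> algC})) fmorph_root; apply: gr.
move: gz; rewrite (all_roots_prod_XsubC _ ars) ?uniq_rootsE //; last by rewrite size_g_over // size_map -cardE card_ord.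
rewrite (monicP (monic_g_over _ _ _)) // scale1r root_prod_XsubC => /mapP[i _ ->].
exact: algRvalP.
Qed.

Lemma rational_root_int (p : {poly int}) (x : rat) : p \is monic ->
  root (map_poly intr p) x -> exists m : int, x = m%:~R.
Proof.
move=> monp px; have : (ratr x : algC) \is a Num.int.
  apply: Cint_rat_Aint; first exact: Crat_rat.
  apply: (@root_monic_Aint (map_poly intr p)); first by rewrite -(map_poly_intr (ratr : {rmorphism rat -> algC})) fmorph_root.
    exact: monic_map.
  by apply/polyOverP => i; rewrite coef_map /= intr_int.
by case/intrP => m xm; exists m; apply: (fmorph_inj (ratr : {rmorphism rat -> algC})); rewrite rmorph_int.
Qed.

(* The cubic resolvent of g_4: its roots are r1 r2 + r3 r4 and conjugates. *)
Definition resolvent (t : int) : {poly int} :=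
  'X^3 - (t ^+ 2 + 3 * t + 4) *: 'X - (2 * t ^+ 2 + 6 * t + 9)%:P.

Lemma size_resolvent t : size (resolvent t) = 4%N.
Proof.
rewrite /resolvent -addrA -opprD size_polyDl size_polyXn // size_polyN.
rewrite (leq_ltn_trans (size_polyD _ _)) // gtn_max (leq_ltn_trans (size_polyC_leq1 _)) // andbT.
by rewrite (leq_ltn_trans (size_scale_leq _ _)) // size_polyX.
Qed.

Lemma monic_resolvent t : resolvent t \is monic.
Proof.
rewrite monicE lead_coefE size_resolvent /resolvent !coefB coefZ coefX coefXn coefC /=.
by rewrite mulr0 !subr0.
Qed.

Lemma horner_resolvent (R : comNzRingType) t (y : R) : (map_poly intr (resolvent t)).[y] =
  y ^+ 3 - (t%:~R ^+ 2 + 3 * t%:~R + 4) * y - (2 * t%:~R ^+ 2 + 6 * t%:~R + 9).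
Proof.
rewrite /resolvent !rmorphB /= map_polyZ /= map_polyXn map_polyX map_polyC /= !(hornerD, hornerN, hornerZ, hornerX, hornerXn, hornerC).
ring.
Qed.

(* With s = t^2 + 3 t, an integer root y satisfies (y + 2) (y^2 - 2 y - s) = 9. *)
Lemma irreducible_resolvent (t : int) : 4 <= t -> irreducible_poly (map_poly intr (resolvent t) : {poly rat}).
Proof.
move=> ht; apply: cubic_irreducible.
  by rewrite size_map_inj_poly ?size_resolvent //; exact: intr_inj.
move=> x; apply/negP => px; have [y yE] := rational_root_int (monic_resolvent t) px.
have {px} y_eq : y ^+ 3 - (t ^+ 2 + 3 * t + 4) * y - (2 * t ^+ 2 + 6 * t + 9) = 0.
  by apply: (@intr_inj rat); rewrite -[RHS](rootP px) yE horner_resolvent; ring.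
have fac : (y + 2) * (y ^+ 2 - 2 * y - (t ^+ 2 + 3 * t)) = 9 by rewrite -[RHS]addr0 -[in RHS]y_eq; ring.
have : (absz (y + 2)%R %| 9)%N by rewrite -[9%N]/(absz 9) -fac abszM dvdn_mulr.
have : y + 2 = (absz (y + 2))%:Z \/ y + 2 = - (absz (y + 2))%:Z by lia.
case: (absz (y + 2)) => [|[|[|[|[|[|[|[|[|[|m]]]]]]]]]] // yE' _.
all: case: yE' => yE'; have {}yE' := canRL (addrK _) yE'; move: fac; rewrite yE'.
(* The divisors of 9 force t^2 + 3t to be -6, -4, 24, 34, 38 or 144. From t = 11 on it is at least
   154, and the smaller values of t are checked one by one. *)
all: have [t11|] : 11 <= t \/ (t = 4 \/ t = 5 \/ t = 6 \/ t = 7 \/ t = 8 \/ t = 9 \/ t = 10) by lia.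
all: try by have : 0 <= (t - 11) * (t + 14); [apply: mulr_ge0; lia | lia].
all: by case=> [->|[->|[->|[->|[->|[->|->]]]]]].
Qed.

Lemma even_or_odd (m : int) : exists q, m = 2 * q \/ m = 2 * q + 1.
Proof. by exists (m %/ 2)%Z; have := divz_eq m 2; have := ltz_pmod m (isT : 0 < 2 :> int); have := modz_ge0 m (isT : 2 != 0 :> int); lia. Qed.

(* The right-hand side is congruent to 5 modulo 8. *)
Lemma discriminant_not_square (t m s : int) : s = t ^+ 2 + 3 * t ->
  m ^+ 2 <> 4 * s ^+ 3 - 60 * s ^+ 2 - 780 * s - 1931.
Proof.
move=> st.
have mul_succ_even (u : int) : exists q, u * (u + 1) = 2 * q.
  have [q [] ->] := even_or_odd u; [exists (q * (2 * q + 1))|exists ((2 * q + 1) * (q + 1))]; ring.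
have [r sE] : exists r, s = 2 * r.
  have [q tE] := mul_succ_even t; exists (q + t); rewrite st; lia.
have [k [] mE] := even_or_odd m; rewrite mE sE; first by lia.
have [q kE] := mul_succ_even k.
rewrite (_ : (2 * k + 1) ^+ 2 = 4 * (k * (k + 1)) + 1) ?kE; [lia|lia].
Qed.

(** The hypotheses are the coefficients of g_4 = (X^2 - aX + b)(X^2 - a'X + b'). Stated without
    roots, it applies both over a subfield and over the splitting field. *)
Lemma resolvent_root (R : comNzRingType) (t : int) (a b a' b' : R) :
  a + a' = t%:~R + 3 -> b + b' + a * a' = 0 -> a * b' + a' * b = - t%:~R ->
  b * b' = 1 -> root (map_poly intr (resolvent t)) (b + b').
Proof.
move=> e3 e2 e1 e0; rewrite /root horner_resolvent.
have -> : (b + b') ^+ 3 - (t%:~R ^+ 2 + 3 * t%:~R + 4) * (b + b') - (2 * t%:~R ^+ 2 + 6 * t%:~R + 9) =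
    (b + b') ^+ 3 - (t%:~R * (t%:~R + 3) + 4) * (b + b') - ((t%:~R + 3) ^+ 2 + (- t%:~R) ^+ 2) by ring.
rewrite -e3 -[t%:~R]opprK -e1 opprK.
have -> : (b + b') ^+ 3 - (- (a * b' + a' * b) * (a + a') + 4) * (b + b') -
    ((a + a') ^+ 2 + (a * b' + a' * b) ^+ 2) =
    (b + b') ^+ 3 - 4 * (b + b') - (a + a') ^+ 2 + ((a + a') ^+ 2 - 2 * (a * a')) * (b * b') +
    (a * a') * ((b + b') ^+ 2 - 2 * (b * b')) by ring.
have -> : a * a' = - (b + b') by apply/eqP; rewrite -subr_eq0 opprK addrC e2.
by rewrite e0; apply/eqP; ring.
Qed.

Lemma dim_Fadjoin_resolvent (t : int) (L : fieldExtType rat) (y : L) : 4 <= t ->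
  root (map_poly intr (resolvent t)) y -> \dim <<1; y>> = 3%N.
Proof.
move=> ht ry; rewrite (@dim_Fadjoin1 _ _ _ (map_poly intr (resolvent t))).
- by rewrite size_map_inj_poly ?size_resolvent //; exact: intr_inj.
- exact: irreducible_resolvent.
- by rewrite map_poly_intr.
Qed.

Lemma dim_Fadjoin_g (n : nat) (t : int) (L : fieldExtType rat) (alpha : L) : (4 <= n)%N -> 4 <= t ->
  root (g_over L n t) alpha -> \dim <<1; alpha>> = n.
Proof.
move=> hn ht ga; rewrite (@dim_Fadjoin1 _ _ _ (g_over rat n t)).
- by rewrite size_g_over.
- exact: irreducible_g.
- by rewrite /g_over map_poly_intr.
Qed.

Lemma g4_quadratic_factors (K : comNzRingType) (t : int) (h m : {poly K}) :
  size h = 3%N -> size m = 3%N -> h \is monic -> m \is monic -> g_over K 4 t = h * m ->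
  [/\ - m`_1 + - h`_1 = t%:~R + 3, m`_0 + h`_0 + - m`_1 * - h`_1 = 0,
      - m`_1 * h`_0 + - h`_1 * m`_0 = - t%:~R & m`_0 * h`_0 = 1].
Proof.
move=> sh sm h_monic m_monic gE.
have [m2 h2] : m`_2 = 1 /\ h`_2 = 1.
  by split; [have /monicP := m_monic|have /monicP := h_monic]; rewrite lead_coefE ?sm ?sh.
have [[m3 m4] [h3 h4]] : (m`_3 = 0 /\ m`_4 = 0) /\ (h`_3 = 0 /\ h`_4 = 0).
  by rewrite !nth_default ?sm ?sh.
have coefg i : (g_over K 4 t)`_i = \sum_(j < i.+1) h`_j * m`_(i - j) by rewrite gE coefM.
have c3 : - (t%:~R + 3) = h`_1 + m`_1.
  transitivity (g_over K 4 t)`_3; last first.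
    by rewrite coefg !big_ord_recl big_ord0 /= /bump !leq0n !add1n ?subSS ?subn0 h2 h3 m3 m2 mulr0 mulr1 mul1r mul0r !addr0 add0r.
  by rewrite g_overE !coefD coefN !coefZ coefX !coefXn coef1 /= rmorphD mulr1 mulr0 sub0r !addr0.
have c2 : 0 = h`_0 + h`_1 * m`_1 + m`_0.
  transitivity (g_over K 4 t)`_2; last first.
    by rewrite coefg !big_ord_recl big_ord0 /= /bump !leq0n !add1n ?subSS ?subn0 h2 m2 mulr1 mul1r !addr0 addrA.
  by rewrite g_overE !coefD coefN !coefZ coefX !coefXn coef1 /= !mulr0 subr0 !addr0.
have c1 : t%:~R = h`_0 * m`_1 + h`_1 * m`_0.
  transitivity (g_over K 4 t)`_1; last first.
    by rewrite coefg !big_ord_recl big_ord0 /= /bump !leq0n !add1n ?subSS ?subn0 !addr0.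
  by rewrite g_overE !coefD coefN !coefZ coefX !coefXn coef1 /= !mulr0 mulr1 subr0 add0r addr0.
have c0 : 1 = h`_0 * m`_0.
  transitivity (g_over K 4 t)`_0; last first.
    by rewrite coefg !big_ord_recl big_ord0 /= addr0.
  by rewrite g_overE !coefD coefN !coefZ coefX !coefXn coef1 /= !mulr0 subr0 !add0r.
split.
- by rewrite -opprD addrC -c3 opprK.
- by apply: etrans (esym c2); ring.
- by rewrite c1; ring.
- by rewrite mulrC -c0.
Qed.

Lemma no_quadratic_subfield (t : int) (L : fieldExtType rat) (alpha : L) (K : {subfield L}) : 4 <= t ->
  root (g_over L 4 t) alpha -> (K <= <<1; alpha>>)%VS -> \dim K <> 2%N.
Proof.
move=> ht ga sK dK; have dim4 := dim_Fadjoin_g (isT : 4 <= 4)%N ht ga.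
have Kalpha : <<K; alpha>>%VS = <<1; alpha>>%VS.
  apply/eqP; rewrite eqEsubv; apply/andP; split; last by rewrite adjoinSl ?sub1v.
  by apply/FadjoinP; rewrite sK memv_adjoin.
(* Tower law: 4 = 2 * 2, so the minimal polynomial of [alpha] over [K] is one of two quadratic
   factors. *)
have deg2 : adjoin_degree K alpha = 2%N.
  have /eqP := dim_Fadjoin K alpha.
  by rewrite Kalpha dim4 dK -[4%N]/(2 * 2)%N eqn_pmul2r // => /eqP.
have gK : g_over L 4 t \is a polyOver K.
  by apply/polyOverP => i; rewrite coef_map /= rpred_int.
have := minPoly_dvdp gK ga; set m := minPoly K alpha => mg.
have sm : size m = 3%N by rewrite size_minPoly deg2.
have m_monic : m \is monic := monic_minPoly K alpha.
have mK : m \is a polyOver K := minPolyOver K alpha.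
pose h := g_over L 4 t %/ m.
have hK : h \is a polyOver K by apply: divp_polyOver.
have gE : g_over L 4 t = h * m by rewrite divpK.
have h_monic : h \is monic by rewrite -(monicMr _ m_monic) -gE monic_g_over.
have sh : size h = 3%N by rewrite size_divp ?monic_neq0 // size_g_over // sm.
have [e3 e2 e1 e0] := g4_quadratic_factors sh sm h_monic m_monic gE.
have y_root := resolvent_root e3 e2 e1 e0.
have yK : (<<1; m`_0 + h`_0>> <= K)%VS.
  by apply/FadjoinP; rewrite sub1v rpredD //; [apply: (polyOverP mK)|apply: (polyOverP hK)].
by have := dimvS yK; rewrite (dim_Fadjoin_resolvent ht y_root) dK.
Qed.

(** * The Galois group of g_4 *)

(** A subgroup of index 2 is normal, so one transposition in it brings in all transpositions, which
    generate. If it contains none, then, a product of two outside elements being inside, membership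
    is parity, against the odd [s]. *)
Lemma perm_group_index_le2 (n : nat) (H : {group 'S_n.+1}) (s : 'S_n.+1) :
  (#|[set: 'S_n.+1] : H|%g <= 2)%N -> s \in H -> odd_perm s -> H = [set: 'S_n.+1]%G.
Proof.
move=> iH sH odd_s; have [i1|i1] := eqVneq #|[set: 'S_n.+1] : H|%g 1%N.
  by apply/val_inj/eqP; rewrite /= eqEsubset subsetT -indexg_eq1 i1.
have i2 : #|[set: 'S_n.+1] : H|%g = 2%N.
  by have := indexg_gt0 [set: 'S_n.+1] H; move: i1 iH; case: #|_ : _|%g => [|[|[|]]].
have nH : (H <| [set: 'S_n.+1])%g := index2_normal (subsetT _) i2.
have nonmem2 (u v : 'S_n.+1) : u \notin H -> v \notin H -> (u * v)%g \in H.
  move=> uH vH; have := rcoset_index2 (x := v^-1%g) (subsetT H) i2.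
  rewrite !inE andbT groupV => /(_ vH) eqH.
  by have := uH; rewrite -[u \notin H]andbT -(in_setT u) -in_setD -eqH mem_rcoset invgK.
have [/existsP[x /existsP[y /andP[neq_xy xyH]]]|none] :=
    boolP [exists x : 'I_n.+1, exists y, (x != y) && (tperm x y \in H)].
  apply/val_inj/eqP; rewrite /= eqEsubset subsetT -(gen_tperm x) gen_subG.
  apply/subsetP => _ /imsetP[z _ ->]; have [->|neq_xz] := eqVneq x z; first by rewrite tperm1 group1.
  have [<-//|neq_yz] := eqVneq y z.
  rewrite tpermC -(tpermJ_tperm (x := y)) 1?eq_sym // tpermC.
  by rewrite memJ_norm // (subsetP (normal_norm nH)) ?inE.
have tperm_notin (x y : 'I_n.+1) : x != y -> tperm x y \notin H.
  by move=> neq_xy; apply: contra none => xyH; apply/existsP; exists x; apply/existsP; exists y; rewrite neq_xy.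
have parity (ts : seq ('I_n.+1 * 'I_n.+1)) : all dpair ts ->
    ((\prod_(t <- ts) tperm t.1 t.2)%g \in H) = ~~ odd (size ts).
  elim: ts => [|p ts IH] /=; first by rewrite big_nil group1.
  case/andP=> /tperm_notin pH /IH{IH} tsH; rewrite big_cons negbK.
  case: (boolP (odd (size ts))) tsH => _ tsH; first by rewrite nonmem2 ?tsH.
  by rewrite groupMr // (negPf pH).
have [ts sE dts] := prod_tpermP s.
by move: sH odd_s; rewrite sE parity // odd_perm_prod // => /negPf->.
Qed.

Section GaloisAction.

Variables (F : fieldType) (M : splittingFieldType F) (E : {subfield M}) (n : nat).
Variables (p : {poly F}) (r : 'I_n -> M).
Hypotheses (pE : map_poly (in_alg M) p = \prod_i ('X - (r i)%:P)).
Hypotheses (r_inj : injective r) (E_gen : <<1 & codom r>>%VS = E).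

Let rE i : r i \in E.
Proof. by rewrite -E_gen; apply: seqv_sub_adjoin; apply: codom_f. Qed.

Lemma gal_perm_exists : exists phi : gal_of E -> 'S_n, forall x i, r (phi x i) = x (r i).
Proof.
suff perm_exists (x : gal_of E) : exists s : 'S_n, forall i, r (s i) = x (r i).
  exact: fin_all_exists perm_exists.
have ex_j i : exists j, r j = x (r i).
  have : root (map_poly (in_alg M) p) (x (r i)).
    have -> : map_poly (in_alg M) p = map_poly x (map_poly (in_alg M) p).
      rewrite -map_poly_comp; apply: eq_map_poly => a /=.
      by rewrite linearZ /= rmorph1.
    by rewrite fmorph_root pE /root horner_prod (bigD1 i) //= hornerXsubC subrr mul0r.
  rewrite pE /root horner_prod prodf_seq_eq0 => /hasP[j _ /=].
  by rewrite hornerXsubC subr_eq0 => /eqP ->; exists j.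
have [f fE] := fin_all_exists ex_j.
have f_inj : injective f.
  by move=> i j /(congr1 r); rewrite !fE => /fmorph_inj/r_inj.
by exists (perm f_inj) => i; rewrite permE.
Qed.

Let delta := \det (Vandermonde n (\row_j r j)).

(** [delta] is a square root of the discriminant; an automorphism permutes the columns of its
    matrix, which costs the sign. *)
Lemma gal_Vandermonde (x : gal_of E) (s : 'S_n) : (forall i, r (s i) = x (r i)) ->
  x delta = (-1) ^+ odd_perm s * delta.
Proof.
move=> sE; rewrite /delta -det_map_mx.
have -> : map_mx x (Vandermonde n (\row_j r j)) = col_perm s (Vandermonde n (\row_j r j)).
  by apply/matrixP => i j; rewrite !mxE rmorphXn sE.
by rewrite col_permE det_mulmx det_perm odd_permV mulrC.
Qed.

Lemma gal_eq1 (x : gal_of E) : (forall i, x (r i) = r i) -> x = 1%g.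
Proof.
move=> fix_r; apply/eqP/gal_eqP => a aE; rewrite gal_id.
suff /subvP/(_ a aE) : (E <= fixedField [set x])%VS.
  by case/mem_fixedFieldP => _; apply; rewrite set11.
rewrite -[X in (X <= _)%VS]E_gen; apply/Fadjoin_seqP; split; first exact: sub1v.
by move=> _ /codomP[i ->]; apply/fixedFieldP => // y /set1P->.
Qed.

End GaloisAction.

(** The bound on the dimension says that the group has index at most 2. If it acted by even
    permutations only, it would fix the Vandermonde determinant, which would then lie in the base
    field. *)
Theorem Galois_group_Sym (F : fieldType) (M : splittingFieldType F) (E : {subfield M}) (n : nat)
    (p : {poly F}) (r : 'I_n.+1 -> M) :
  map_poly (in_alg M) p = \prod_i ('X - (r i)%:P) -> injective r -> <<1 & codom r>>%VS = E ->
  (n.+1`! <= 2 * \dim E)%N -> \det (Vandermonde n.+1 (\row_j r j)) \notin 1%VS ->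
  ('Gal(E / 1) \isog 'Sym_('I_n.+1))%g.
Proof.
move=> pE r_inj E_gen dimE delta_irr.
have prE : \prod_i ('X - (r i)%:P) = \prod_(z <- codom r) ('X - z%:P) by rewrite big_image.
have galE : galois 1 E.
  apply/splitting_galoisField; exists (map_poly (in_alg M) p); split.
  - by apply/polyOver1P; exists p.
  - by rewrite pE prE separable_prod_XsubC map_inj_uniq ?enum_uniq.
  - by exists (codom r); rewrite ?pE ?prE ?eqpxx.
have rE i : r i \in E by rewrite -E_gen seqv_sub_adjoin ?codom_f.
have [phi phiE] := gal_perm_exists E pE r_inj.
have phiM : {in 'Gal(E / 1)%g &, {morph phi : x y / (x * y)%g}}.
  move=> x y _ _; apply/permP => i; apply: r_inj.
  by rewrite permM !phiE galM.
pose phim := Morphism phiM.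
have inj_phi : ('injm phim)%g.
  apply/subsetP => x /morphpreP[_ /set1P /= phix].
  apply/set1P; apply: (gal_eq1 E_gen) => i.
  by rewrite -phiE phix perm1.
have := sub_isog (subxx _) inj_phi.
have -> // : (phim @* 'Gal(E / 1) = 'Sym_('I_n.+1))%g.
have /existsP[x /andP[xG odd_x]] : [exists x, (x \in 'Gal(E / 1)%g) && odd_perm (phi x)].
  apply: contraR delta_irr => /existsPn even.
  have := galois_fixedField galE => <-.
  apply/fixedFieldP.
    by rewrite det_Vandermonde; apply: rpred_prod => i _; apply: rpred_prod => j _; rewrite !mxE rpredB.
  move=> x xG; rewrite (gal_Vandermonde (phiE x)).
  by have := even x; rewrite xG /= => /negPf->; rewrite mul1r.
apply: (congr1 val (perm_group_index_le2 _ _ odd_x)); last exact: (mem_morphim phim).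
have G0 := cardG_gt0 (phim @* 'Gal(E / 1))%G.
rewrite -(leq_pmul2l G0) (Lagrange (subsetT _)) cardsT card_Sn.
by rewrite card_injm // -galois_dim // dimv1 divn1 mulnC.
Qed.

(** Differences of resolvent roots factor through differences of roots, as in y1 - y2 = (a - d)(b -
    c), so quartic and resolvent share their discriminant. As y1 + y2 + y3 = 0, it is -4P^3 - 27Q^2
    with P = -(s + 4) and Q = 2s + 9. *)
Lemma quartic_discriminant (R : comNzRingType) (t : int) (a b c d : R) :
  (a + b) + (c + d) = t%:~R + 3 -> a * b + c * d + (a + b) * (c + d) = 0 ->
  (a + b) * (c * d) + (c + d) * (a * b) = - t%:~R -> a * b * (c * d) = 1 ->
  let s := t ^+ 2 + 3 * t in
  ((b - a) * (c - a) * (d - a) * ((c - b) * (d - b)) * (d - c)) ^+ 2 =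
  (4 * s ^+ 3 - 60 * s ^+ 2 - 780 * s - 1931)%:~R.
Proof.
move=> e1 e2 e3 e4 s.
pose y1 := a * b + c * d; pose y2 := a * c + b * d; pose y3 := a * d + b * c.
have sum0 : y3 = - (y1 + y2).
  by apply/eqP; rewrite -subr_eq0 opprK -e2 /y1 /y2 /y3; apply/eqP; ring.
have P : y1 * y2 + (y1 + y2) * y3 = - (s%:~R + 4).
  transitivity (((a + b) + (c + d)) * ((a + b) * (c * d) + (c + d) * (a * b)) - 4 * (a * b * (c * d))).
    by rewrite /y1 /y2 /y3; ring.
  by rewrite e1 e3 e4 /s; ring.
have Q : y1 * y2 * y3 = 2 * s%:~R + 9.
  transitivity (((a + b) * (c * d) + (c + d) * (a * b)) ^+ 2 +
    ((a + b) + (c + d)) ^+ 2 * (a * b * (c * d)) -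
    4 * (a * b + c * d + (a + b) * (c + d)) * (a * b * (c * d))).
    by rewrite /y1 /y2 /y3; ring.
  by rewrite e1 e2 e3 e4 /s; ring.
transitivity (- 4 * (y1 * y2 + (y1 + y2) * y3) ^+ 3 - 27 * (y1 * y2 * y3) ^+ 2).
  transitivity (((y1 - y2) * (y1 - y3) * (y2 - y3)) ^+ 2); last by rewrite sum0; ring.
  by rewrite /y1 /y2 /y3; ring.
by rewrite P Q; ring.
Qed.

Lemma sqrt_rational_int (m : int) (M : fieldExtType rat) (x : M) :
  x ^+ 2 = m%:~R -> x \in 1%VS -> exists k : int, m = k ^+ 2.
Proof.
move=> x2 /vlineP[a xa].
have a2 : a ^+ 2 = m%:~R.
  by apply: (fmorph_inj (in_alg M)); rewrite rmorphXn rmorph_int -x2 xa.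
have [|k ak] := @rational_root_int ('X^2 - m%:P) a (monicXnsubC _ (isT : 0 < 2)%N).
  by rewrite rmorphB /= map_polyXn map_polyC /= /root !hornerE ?hornerXn a2 subrr.
by exists k; apply: (@intr_inj rat); rewrite rmorphXn -a2 ak.
Qed.

Lemma g4_Galois_group (t : int) (M : splittingFieldType rat) (E : {subfield M}) : 4 <= t ->
  splittingFieldFor 1 (g_over M 4 t) E -> ('Gal(E / 1) \isog 'Sym_('I_4))%g.
Proof.
move=> ht [rs gE E_gen].
have g_monic := monic_g_over M t (isT : 4 <= 4)%N.
have {}gE : g_over M 4 t = \prod_(z <- rs) ('X - z%:P).
  by apply/eqP; rewrite -eqp_monic // monic_prod_XsubC.
have size_rs : size rs = 4%N.
  by have := size_g_over M t (isT : 4 <= 4)%N; rewrite gE size_prod_XsubC => -[].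
case: rs size_rs gE E_gen => [|a [|b [|c [|d []]]]] // _ gE E_gen.
pose r := tnth [tuple a; b; c; d].
have codom_r : codom r = [:: a; b; c; d] by exact: map_tnth_enum.
have quadE (x y : M) : ('X - x%:P) * ('X - y%:P) = 'X^2 - (x + y) *: 'X + (x * y)%:P.
  by rewrite -mul_polyC !rmorphD !rmorphM /=; ring.
have quad_monic (x y : M) : ('X - x%:P) * ('X - y%:P) \is monic by rewrite rpredM ?monicXsubC.
have quad_size (x y : M) : size (('X - x%:P) * ('X - y%:P)) = 3%N.
  by rewrite size_monicM ?monicXsubC ?polyXsubC_eq0 // !size_XsubC.
have quad0 (x y : M) : (('X - x%:P) * ('X - y%:P))`_0 = x * y.
  by rewrite quadE !coefD coefN coefZ coefX coefXn coefC /= mulr0 subr0 add0r.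
have quad1 (x y : M) : (('X - x%:P) * ('X - y%:P))`_1 = - (x + y).
  by rewrite quadE !coefD coefN coefZ coefX coefXn coefC /= mulr1 add0r addr0.
have gE4 : g_over M 4 t = (('X - c%:P) * ('X - d%:P)) * (('X - a%:P) * ('X - b%:P)).
  by rewrite gE !big_cons big_nil; ring.
have := g4_quadratic_factors (quad_size c d) (quad_size a b) (quad_monic c d) (quad_monic a b) gE4.
rewrite !quad0 !quad1 !opprK => -[e3 e2 e1 e0].
have delta2 := quartic_discriminant e3 e2 e1 e0.
pose delta := (b - a) * (c - a) * (d - a) * ((c - b) * (d - b)) * (d - c).
have not_square (k : int) := @discriminant_not_square t k _ erefl.
have deltaE : \det (Vandermonde 4 (\row_j r j)) = delta.
  rewrite det_Vandermonde !big_ord_recl big_ord0.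
  do 4![rewrite big_mkcond !big_ord_recl big_ord0 /=].
  by rewrite !mxE /r !(tnth_nth 0) /= /delta; ring.
have delta_irr : delta \notin 1%VS.
  by apply/negP => /(sqrt_rational_int delta2)[k /esym]; apply: not_square.
(* Irrationality of [delta] also shows that the four roots are distinct. *)
have delta_neq0 : delta != 0 by apply: contraNneq delta_irr => ->; rewrite mem0v.
have r_inj : injective r.
  apply/tuple_uniqP; rewrite /= !inE !negb_or.
  move: delta_neq0; rewrite /delta !mulf_eq0 !negb_or !subr_eq0 -!andbA.
  by case/and5P=> ba ca da cb /andP[db dc]; rewrite (eq_sym a b) (eq_sym a c) (eq_sym a d) (eq_sym b c) (eq_sym b d) (eq_sym c d) ba ca da cb db dc.
have subE (x : M) : x \in E -> (\dim <<1; x>> %| \dim E)%N.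
  by move=> xE; apply: field_dimS; apply/FadjoinP; rewrite sub1v.
have rsE (x : M) : x \in [:: a; b; c; d] -> x \in E.
  by move=> xrs; rewrite -E_gen seqv_sub_adjoin.
have [aE bE cE dE] : [/\ a \in E, b \in E, c \in E & d \in E].
  by split; apply: rsE; rewrite !inE eqxx ?orbT.
have dvd4 : (4 %| \dim E)%N.
  have ga : root (g_over M 4 t) a by rewrite gE root_prod_XsubC mem_head.
  by rewrite -(dim_Fadjoin_g (isT : 4 <= 4)%N ht ga) subE.
have dvd3 : (3 %| \dim E)%N.
  have y_root := resolvent_root e3 e2 e1 e0.
  by rewrite -(dim_Fadjoin_resolvent ht y_root) subE // rpredD ?rpredM.
have dvd12 : (12 %| \dim E)%N by rewrite (@Gauss_dvd 4 3) // dvd4.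
apply: (@Galois_group_Sym _ _ _ _ (g_over rat 4 t) r) => //.
- by rewrite /g_over map_poly_intr -/(g_over M 4 t) gE -codom_r big_image.
- by rewrite codom_r.
- by rewrite -[4`!]/(2 * 12)%N leq_pmul2l // dvdn_leq // adim_gt0.
- by rewrite deltaE.
Qed.

(** * Units *)

(** Evaluating f - e = q (X - c) at [alpha] gives q(alpha) (alpha - c) = -e, a sign; the inverse is
    therefore -u e q(alpha). The sign [u] allows 1 - alpha to be treated as -(alpha - 1). *)
Lemma integer_unit_of_value (f : {poly int}) (c e u : int) (L : fieldExtType rat) (alpha : L) :
  f \is monic -> root (map_poly intr f) alpha -> f.[c] = e -> e ^+ 2 = 1 -> u ^+ 2 = 1 ->
  is_integer_unit <<1; alpha>>%AS (u%:~R * (alpha - c%:~R)).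
Proof.
move=> monic_f f_alpha fc e2 u2.
have ring_horner (q : {poly int}) : in_ring_of_integers <<1; alpha>>%AS (map_poly intr q).[alpha].
  split.
    by apply: mempx_Fadjoin; apply/polyOverP => i; rewrite coef_map /= rpred_int.
  apply: integral_horner; last by exists f.
  by apply/integral_poly => i; rewrite coef_map; apply: integral_id.
have [q qE] : exists q, f - e%:P = q * ('X - c%:P).
  by apply/factor_theorem; rewrite /root hornerD hornerN hornerC fc subrr.
split.
  have := ring_horner (u%:P * ('X - c%:P)).
  by rewrite rmorphM rmorphB /= !map_polyC map_polyX hornerM hornerXsubC hornerC.
exists (map_poly intr (- (u * e)%:P * q)).[alpha]; first exact: ring_horner.
rewrite rmorphM rmorphN /= map_polyC hornerM hornerN hornerC.
have := congr1 (fun p => (map_poly intr p).[alpha]) qE.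
rewrite rmorphB rmorphM rmorphB /= !map_polyC map_polyX /= !hornerM hornerXsubC !hornerD !hornerN !hornerC.
rewrite (rootP f_alpha) sub0r; set qa := (map_poly intr q).[alpha] => qaE.
transitivity (- (u%:~R * (u * e)%:~R) * (qa * (alpha - c%:~R))); first by ring.
rewrite -qaE mulrNN; transitivity ((u ^+ 2 * e ^+ 2)%:~R : L); first by ring.
by rewrite u2 e2 mulr1.
Qed.

Lemma root_g_exceptional_unit (n : nat) (t : int) (L : fieldExtType rat) (alpha : L) :
  (4 <= n)%N -> root (g_over L n t) alpha -> exceptional_unit <<1; alpha>>%AS alpha.
Proof.
move=> hn ga.
have g_monic : g n t \is monic.
  rewrite monicE -(inj_eq (@intr_inj rat)) -lead_coef_map_inj //; last exact: intr_inj.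
  by rewrite (monicP (monic_g_over _ _ hn)).
have nE : n = (n - 4).+4 by lia.
split.
  have := @integer_unit_of_value (g n t) 0 1 1 L alpha g_monic ga.
  rewrite mul1r subr0; apply=> //.
  by rewrite /g !(hornerD, hornerN, hornerZ, hornerX, hornerXn, hornerC) nE /= !exprS; ring.
have := @integer_unit_of_value (g n t) 1 (-1) (-1) L alpha g_monic ga.
rewrite mulN1r opprB; apply=> //.
by rewrite /g !(hornerD, hornerN, hornerZ, hornerX, hornerXn, hornerC) !expr1n; ring.
Qed.

Lemma unit_group_rank_g4 (t : int) (L : fieldExtType rat) (alpha : L) :
  4 <= t -> root (g_over L 4 t) alpha -> unit_group_rank <<1; alpha>>%AS 3.
Proof.
move=> ht ga; have [r r_inj gr] := real_roots_g4 ht.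
have intr_injr : injective (intr : int -> rat) := @intr_inj rat.
apply: (@totally_real_unit_rank 3 (g 4 t) r) => //.
- rewrite monicE -(inj_eq intr_injr) -lead_coef_map_inj //.
  by rewrite (monicP (monic_g_over _ _ _)).
- by rewrite -(size_map_inj_poly intr_injr) // size_g_over.
- exact: irreducible_g.
Qed.

Theorem theorem4p1 (n : nat) (t : int) (hn : (4 <= n)%N) (ht : 4 <= t) :
  [/\ (* (i) *)
      irreducible_poly (g_over rat n t),
      (* (ii) *)
      forall (L : fieldExtType rat) (alpha : L), root (g_over L n t) alpha ->
        exceptional_unit <<1; alpha>>%AS alpha /\
        exceptional_field <<1; alpha>>%AS,
      (* (iii) *)
      [/\ forall z : algC, root (g_over algC 4 t) z -> z \is Num.real,
          forall (L : fieldExtType rat) (alpha : L),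
            root (g_over L 4 t) alpha ->
            \dim <<1; alpha>> = 4%N /\ unit_group_rank <<1; alpha>>%AS 3
        & forall (M : splittingFieldType rat) (E : {subfield M}),
            splittingFieldFor 1 (g_over M 4 t) E ->
            ('Gal(E / 1) \isog 'Sym_('I_4))%g]
    & (* (iv) *)
      forall (L : fieldExtType rat) (alpha : L), root (g_over L 4 t) alpha ->
        forall K : {subfield L}, (K <= <<1; alpha>>)%VS -> \dim K <> 2%N].
Proof.
split; first exact: irreducible_g.
- move=> L alpha /(root_g_exceptional_unit hn) exc.
  by split=> //; exists alpha.
- split=> [z|L alpha ga|M E]; first exact: g4_roots_real.
    by split; [exact: dim_Fadjoin_g ht ga | exact: unit_group_rank_g4 ht ga].
  exact: g4_Galois_group.
- by move=> L alpha ga K; apply: no_quadratic_subfield ht ga.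
Qed.
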